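(* Let $\Omega\subset\mathbb{R}^d$ be open and let $c\in\mathcal{C}^2(\Omega^2)$ be infinitesimally twisted. Let $\mu_0,\mu_1$ be two compactly supported probability measures on $\Omega$ of finite entropy. For $\varepsilon>0$ let $\gamma_\varepsilon$ be the minimizer of the entropic optimal transport problem with cost $c$ between $\mu_0$ and $\mu_1$, and let $\gamma_0$ be any optimal transport plan for the problem with $\varepsilon=0$. Then there exists a constant $a>0$ such that, as $\varepsilon\to0^+$ (i.e. for all sufficiently small $\varepsilon>0$), $$W_2^2(\gamma_\varepsilon,\gamma_0)\ge a\,\varepsilon.$$
   Context: A cost $c\in\mathcal{C}^2(\Omega^2)$ is infinitesimally twisted if the matrix $\nabla^2_{xy}c(x,y)=(\partial^2_{x_iy_j}c(x,y))_{i,j}\in M_d(\mathbb{R})$ is invertible for every $(x,y)\in\Omega^2$. $\Pi(\mu_0,\mu_1)$ is the set of probability measures with marginals $\mu_0,\mu_1$. $\mathcal{H}^k$ is the Lebesgue measure on $\mathbb{R}^k$. For a compactly supported probability measure $\mu$ on $\mathbb{R}^k$, the entropy is $H(\mu)=H(\mu\mid\mathcal{H}^k)=\int\ln(\mu(x))\,d\mu(x)$ if $\mu$ has density $\mu(x)$, and $+\infty$ otherwise. For $\varepsilon>0$, $\gamma_\varepsilon$ is the minimizer of $\int c\,d\gamma+\varepsilon H(\gamma\mid\mathcal{H}^{2d})$ over $\gamma\in\Pi(\mu_0,\mu_1)$; $\gamma_0$ is any minimizer of $\int c\,d\gamma$ over $\Pi(\mu_0,\mu_1)$ (not necessarily unique).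 $W_2$ is the 2-Wasserstein distance on probability measures on $\mathbb{R}^{2d}$ (Euclidean distance). *)

(* Defs.v *)
From HB Require Import structures.
From mathcomp Require Import all_boot all_order all_algebra.
From mathcomp Require Import all_classical all_reals all_analysis.
From mathcomp Require Import measurable_realfun.

Set Implicit Arguments.
Unset Strict Implicit.
Unset Printing Implicit Defensive.

Import Order.TTheory GRing.Theory Num.Theory.
Import numFieldNormedType.Exports.

Local Open Scope classical_set_scope.
Local Open Scope ring_scope.

(* Real matrices, hence row vectors, carry their Borel sigma-algebra. *)
HB.instance Definition _ (R : realType) (m n : nat) :=
  Measurable.copy 'M[R]_(m, n) (g_sigma_algebraType (@open 'M[R]_(m, n))).

Section borel_matrix.
Context {R : realType} {m n : nat}.

Lemma open_measurable_mx (A : set 'M[R]_(m, n)) : open A -> measurable A.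
Proof. exact: sub_sigma_algebra. Qed.

Lemma open_bigcup_rat_ball (A : set 'M[R]_(m, n)) : open A ->
  A = \bigcup_(p in [set p : 'M[rat]_(m, n) * nat |
        ball (map_mx ratr p.1 : 'M[R]_(m, n)) p.2.+1%:R^-1 `<=` A])
      ball (map_mx ratr p.1 : 'M[R]_(m, n)) p.2.+1%:R^-1.
Proof.
move=> oA; apply/seteqP; split=> [x Ax|x [p /= pA /pA]//].
have /nbhs_ballP[e /= e0 xeA] : nbhs x A by exact: open_nbhs_nbhs.
have [k ke] : exists k : nat, k.+1%:R^-1 < e / 2 :> R.
  have [k _ /(_ k (leqnn k)) kP] :=
    near_infty_natSinv_lt (PosNum (divr_gt0 e0 (ltr0Sn R 1))).
  by exists k.
have k0 : 0 < k.+1%:R^-1 :> R by rewrite invr_gt0.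
have H i j : {q : rat | ratr q \in `]x i j, x i j + k.+1%:R^-1[}.
  by apply/cid/rat_in_itvoo; rewrite ltrDl.
pose q : 'M[rat]_(m, n) := \matrix_(i, j) sval (H i j).
have qx : ball (map_mx ratr q : 'M[R]_(m, n)) k.+1%:R^-1 x.
  split=> // i j; rewrite !mxE; case: (H i j) => r /=.
  rewrite in_itv /= => /andP[xr rx].
  by rewrite /ball /= gtr0_norm ?subr_gt0// ltrBlDl.
exists (q, k) => //= y qy; apply: xeA.
rewrite [e]splitr; apply: (@ball_triangle _ _ (map_mx ratr q : 'M[R]_(m, n))).
  by apply: ball_sym; exact: (le_ball (ltW ke)).
exact: (le_ball (ltW ke)).
Qed.

Lemma measurable_fun_coord (i : 'I_m) (j : 'I_n) :
  measurable_fun [set: 'M[R]_(m, n)] (fun M : 'M[R]_(m, n) => M i j).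
Proof.
apply: (measurability _ (RGenOpens.measurableE R)) => _ [_ [a [b ->]] <-].
rewrite setTI; apply: open_measurable_mx.
by apply: open_comp; [move=> M _; exact: coord_continuous|exact: interval_open].
Qed.

Lemma measurable_fun_mxP d (T : measurableType d) (f : T -> 'M[R]_(m, n)) :
  (forall i j, measurable_fun [set: T] (fun t => f t i j)) ->
  measurable_fun [set: T] f.
Proof.
move=> mf.
apply: (@measurability _ _ _ _ _ f (@open 'M[R]_(m, n))) => // _ [A oA <-].
rewrite setTI (open_bigcup_rat_ball oA) preimage_bigcup bigcup_mkcond.
apply: countable_bigcupT_measurable => // -[q k] /=.
case: ifPn => // _.
set x := map_mx ratr q.
rewrite (_ : _ @^-1` _ = \bigcap_(ij in [set: 'I_m * 'I_n])
    (fun t => f t ij.1 ij.2) @^-1` ball (x ij.1 ij.2) k.+1%:R^-1).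
  apply: fin_bigcap_measurable => // -[i j] _.
  rewrite -[X in measurable X]setTI; apply: mf => //.
  by apply: open_measurable; apply: ball_open; rewrite invr_gt0.
apply/seteqP; split=> [t [_ H] [i j] _|t H]; first exact: H.
by split=> [|i j]; [rewrite invr_gt0|exact: (H (i, j) I)].
Qed.

End borel_matrix.

Section lebesgue_rV.
Context {R : realType}.

Definition rV_cons (n : nat) (p : R * 'rV[R]_n) : 'rV[R]_n.+1 :=
  row_mx (const_mx p.1 : 'rV_1) p.2.

Lemma rV_cons0 n (p : R * 'rV[R]_n) : rV_cons p 0 0 = p.1.
Proof.
have := row_mxEl (const_mx p.1 : 'rV_1) p.2 0 0; rewrite [RHS]mxE => <-.
by congr (row_mx _ _ 0 _); exact: val_inj.
Qed.

Lemma rV_cons_lift n (p : R * 'rV[R]_n) (j : 'I_n) :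
  rV_cons p 0 (lift 0 j) = p.2 0 j.
Proof.
rewrite -(row_mxEr (const_mx p.1 : 'rV_1) p.2 0 j).
by congr (row_mx _ _ 0 _); exact: val_inj.
Qed.

Lemma measurable_rV_cons n : measurable_fun [set: R * 'rV[R]_n] (@rV_cons n).
Proof.
apply: measurable_fun_mxP => i j; rewrite (ord1 i).
case: (unliftP 0 j) => [k ->|->].
  rewrite (_ : (fun _ => _) = (fun v : 'rV[R]_n => v 0 k) \o snd); last first.
    by apply/funext => p; rewrite rV_cons_lift.
  by apply: measurableT_comp => //; exact: measurable_fun_coord.
rewrite (_ : (fun _ => _) = fst)//.
by apply/funext => p; rewrite rV_cons0.
Qed.

Section step.
Variables (n : nat) (m : {sigma_finite_measure set 'rV[R]_n -> \bar R}).

Definition lebesgue_rV_step : set 'rV[R]_n.+1 -> \bar R :=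
  pushforward (lebesgue_measure \x m)%E (@rV_cons n).

Let step0 : lebesgue_rV_step set0 = 0%E.
Proof. by rewrite /lebesgue_rV_step /pushforward preimage_set0 measure0. Qed.

Let step_ge0 A : (0 <= lebesgue_rV_step A)%E.
Proof. by rewrite /lebesgue_rV_step /pushforward; exact: measure_ge0. Qed.

Let step_additive : semi_sigma_additive lebesgue_rV_step.
Proof.
move=> F mF tF mUF; rewrite /lebesgue_rV_step /pushforward preimage_bigcup.
have mc X : measurable X -> measurable (@rV_cons n @^-1` X).
  by move=> mX; rewrite -[X in measurable X]setTI; exact: measurable_rV_cons.
apply: measure_semi_sigma_additive.
- by move=> k; exact: mc.
- apply/trivIsetP => /= i j _ _ ij; rewrite -preimage_setI.
  by move/trivIsetP : tF => /(_ _ _ _ _ ij) ->//; rewrite preimage_set0.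
- by rewrite -preimage_bigcup; exact: mc.
Qed.

HB.instance Definition _ := isMeasure.Build _ _ _ lebesgue_rV_step
  step0 step_ge0 step_additive.

Definition rV_uncons (v : 'rV[R]_n.+1) : R * 'rV[R]_n :=
  (v 0 0, \row_j v 0 (lift 0 j)).

Lemma rV_consK : cancel (@rV_cons n) rV_uncons.
Proof.
move=> [x v]; rewrite /rV_uncons rV_cons0; congr pair.
by apply/rowP => j; rewrite mxE rV_cons_lift.
Qed.

Lemma measurable_rV_uncons : measurable_fun [set: 'rV[R]_n.+1] rV_uncons.
Proof.
apply: measurable_fun_pair; first exact: measurable_fun_coord.
apply: measurable_fun_mxP => i j; under eq_fun do rewrite mxE.
exact: measurable_fun_coord.
Qed.

Let step_sigma_finite : sigma_finite setT lebesgue_rV_step.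
Proof.
have /sigma_finiteP[F [FT ndF Foo]] := sigma_finiteT (@lebesgue_measure R).
have /sigma_finiteP[G [GT ndG Goo]] := sigma_finiteT m.
exists (fun k => rV_uncons @^-1` (F k `*` G k)) => [|k].
  rewrite -preimage_bigcup (_ : \bigcup_i _ = setT) ?preimage_setT//.
  apply/seteqP; split=> // -[x v] _.
  have [i _ Fx] : (\bigcup_i F i) x by rewrite -FT.
  have [j _ Gv] : (\bigcup_i G i) v by rewrite -GT.
  exists (maxn i j) => //; split.
    by move: (x) Fx; exact/subsetPset/ndF/leq_maxl.
  by move: (v) Gv; exact/subsetPset/ndG/leq_maxr.
have [mF Fk] := Foo k; have [mG Gk] := Goo k.
have mFG : measurable (F k `*` G k) by exact: measurableX.
split; first by rewrite -[X in measurable X]setTI; exact: measurable_rV_uncons.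
rewrite /lebesgue_rV_step /pushforward -comp_preimage.
rewrite (_ : rV_uncons \o _ = id); last by apply/funext => p; exact: rV_consK.
by rewrite preimage_id product_measure1E// lte_mul_pinfty// ge0_fin_numE.
Qed.

HB.instance Definition _ := Measure_isSigmaFinite.Build _ _ _ lebesgue_rV_step
  step_sigma_finite.

End step.

(* Lebesgue measure on R^n, by iterated products with the one-dimensional one;
   see lebesgue_rV_box for the volume of boxes. *)
Fixpoint lebesgue_rV (n : nat) : {sigma_finite_measure set 'rV[R]_n -> \bar R} :=
  match n with
  | 0 => \d_(0 : 'rV[R]_0)
  | k.+1 => lebesgue_rV_step (lebesgue_rV k)
  end.

Lemma lebesgue_rV_box n (a b : 'rV[R]_n) : (forall i, a 0 i <= b 0 i) ->
  lebesgue_rV n [set v : 'rV[R]_n | forall i, v 0 i \in `[a 0 i, b 0 i]] =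
  (\prod_i (b 0 i - a 0 i))%:E.
Proof.
elim: n a b => [|n IH] a b ab /=.
  rewrite big_ord0 diracE mem_set// => -[[]//].
rewrite /lebesgue_rV_step /pushforward.
pose a' := (rV_uncons a).2; pose b' := (rV_uncons b).2.
rewrite (_ : _ @^-1` _ = [set` `[a 0 0, b 0 0]] `*`
    [set v : 'rV[R]_n | forall i, v 0 i \in `[a' 0 i, b' 0 i]]); last first.
  apply/seteqP; split=> [[x v] /= H|[x v] [/= H1 H2] i].
    split; first by have := H 0; rewrite rV_cons0.
    by move=> i; have := H (lift 0 i); rewrite rV_cons_lift !mxE.
  case: (unliftP 0 i) => [j ->|->]; last by rewrite rV_cons0.
  by rewrite rV_cons_lift; have := H2 j; rewrite !mxE.
rewrite product_measure1E//; last first.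
  rewrite (_ : [set _ | _] = \bigcap_(i in [set: 'I_n])
      (fun v : 'rV[R]_n => v 0 i) @^-1` [set` `[a' 0 i, b' 0 i]]).
    apply: fin_bigcap_measurable => // i _.
    rewrite -[X in measurable X]setTI.
    by apply: measurable_fun_coord => //; exact: measurable_itv.
  by apply/seteqP; split=> [v H i _|v H i]; exact: H.
rewrite IH; last by move=> i; rewrite !mxE.
rewrite big_ord_recl EFinM; congr (_ * _)%E; last first.
  by congr EFin; apply: eq_bigr => i _; rewrite !mxE.
apply: (etrans (lebesgue_measure_itv `[a 0 0, b 0 0])).
rewrite /= lte_fin; have := ab 0.
by rewrite le_eqVlt => /predU1P[->|->]; rewrite ?ltxx ?subrr.
Qed.

End lebesgue_rV.

Arguments lebesgue_rV : clear implicits.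

Section entropy.
Local Open Scope ereal_scope.
Context d (T : measurableType d) (R : realType).

Definition is_density (m : {measure set T -> \bar R}) (mu : probability T R)
    (f : T -> R) :=
  [/\ measurable_fun setT f, forall x, (0 <= f x)%R &
      forall A, measurable A -> mu A = \int[m]_(x in A) (f x)%:E].

(* The density is unique almost everywhere, so that its choice is irrelevant.
   The value of ln at 0 is irrelevant too, as mu vanishes on [set x | f x = 0]. *)
Definition entropy (m : {measure set T -> \bar R}) (mu : probability T R) :
    \bar R :=
  if pselect (exists f, is_density m mu f) is left h
  then \int[mu]_x (ln (sval (cid h) x))%:E
  else +oo.

End entropy.

Section transport.
Local Open Scope ereal_scope.
Context d1 d2 (T1 : measurableType d1) (T2 : measurableType d2) (R : realType).

Definition coupling (mu : probability T1 R) (nu : probability T2 R)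
    (g : probability (T1 * T2)%type R) :=
  (forall A, measurable A -> pushforward g fst A = mu A) /\
  (forall B, measurable B -> pushforward g snd B = nu B).

End transport.

Section wasserstein.
Local Open Scope ereal_scope.
Context d (T : measurableType d) (R : realType).

Definition W2 (dist : T -> T -> R) (mu nu : probability T R) : \bar R :=
  (ereal_inf [set \int[g]_z (dist z.1 z.2 ^+ 2)%:E | g in coupling mu nu])
    `^ 2^-1.

End wasserstein.

(* mathcomp-analysis norms 'rV[R]_n and products with sup norms. *)
Definition eucl_dist (R : realType) (n : nat) (z w : 'rV[R]_n * 'rV[R]_n) : R :=
  Num.sqrt (\sum_i (z.1 0 i - w.1 0 i) ^+ 2 + \sum_i (z.2 0 i - w.2 0 i) ^+ 2).

Definition msupport (R : realType) (n : nat) (mu : set 'rV[R]_n -> \bar R) :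
    set 'rV[R]_n :=
  [set x | forall U, open U -> U x -> (0 < mu U)%E].

Definition compactly_supported_in (R : realType) (n : nat) (Omega : set 'rV[R]_n)
    (mu : set 'rV[R]_n -> \bar R) :=
  compact (msupport mu) /\ msupport mu `<=` Omega.

(* Intended for open U: derivatives at points of U see f near U only. *)
Fixpoint Ck_on (R : realType) (V : normedModType R) (k : nat) (U : set V)
    (f : V -> R) : Prop :=
  match k with
  | 0 => forall x, U x -> {for x, continuous f}
  | j.+1 => (forall x, U x -> differentiable f x) /\
            (forall v, Ck_on j U (fun x => 'D_v f x))
  end.

Section cost.
Context {R : realType} {n : nat}.
Implicit Types (Omega : set 'rV[R]_n) (c : 'rV[R]_n * 'rV[R]_n -> R).

(* The matrix of the second derivatives of c in x_i and y_j. *)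
Definition mixed_hessian c (z : 'rV[R]_n * 'rV[R]_n) : 'M[R]_n :=
  \matrix_(i, j)
    'D_(delta_mx 0 i, 0) (fun w => 'D_(0, delta_mx 0 j) c w) z.

Definition inf_twisted Omega c :=
  forall z, (Omega `*` Omega) z -> mixed_hessian c z \in unitmx.

Implicit Types (mu nu : probability 'rV[R]_n R).
Implicit Types (g : probability ('rV[R]_n * 'rV[R]_n)%type R).

(* Only the values of c on Omega `*` Omega are meaningful. *)
Definition transport_cost Omega c g : \bar R :=
  (\int[g]_(z in Omega `*` Omega) (c z)%:E)%E.

Definition optimal_plan Omega c mu nu g :=
  coupling mu nu g /\
  forall g', coupling mu nu g' ->
    (transport_cost Omega c g <= transport_cost Omega c g')%E.

(* R^n x R^n stands for R^(2n), with the product Lebesgue measure. *)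
Definition entropic_cost Omega c (eps : R) g : \bar R :=
  (transport_cost Omega c g
   + eps%:E * entropy (lebesgue_rV R n \x lebesgue_rV R n) g)%E.

Definition entropic_minimizer Omega c mu nu eps g :=
  coupling mu nu g /\
  forall g', coupling mu nu g' ->
    (entropic_cost Omega c eps g <= entropic_cost Omega c eps g')%E.

End cost.

(* Main.v *)
Require Import Defs.
From HB Require Import structures.
From mathcomp Require Import all_boot all_order all_algebra.
From mathcomp Require Import all_classical all_reals all_analysis.
From mathcomp Require Import measurable_realfun ring lra.

Set Implicit Arguments.
Unset Strict Implicit.
Unset Printing Implicit Defensive.

Import Order.TTheory GRing.Theory Num.Theory.
Import numFieldNormedType.Exports.

Local Open Scope classical_set_scope.
Local Open Scope ring_scope.

(** A minimizer [gamma] of the entropic problem with parameter [eps] has to be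
    spread out at scale [sqrt eps], whereas [gamma0] lives on a set of dimension
    [d] in a space of dimension [2d]; the entropy [H] measures both facts.

    Dimension of [gamma0].  Call
    [c(x,y') + c(x',y) - c(x,y) - c(x',y')] the mixed difference of [c] at
    [(x,y)] and [(x',y')].  It is nonnegative on the support of an optimal plan
    ([optimal_monotone]): otherwise, exchanging a little mass between
    neighbourhoods of the two points would lower the cost.  By the mean value
    theorem it equals [- (x-x')^T M (y-y')] where [M] is the mixed Hessian at an
    intermediate point ([mixed_differenceE]).  Near a point where the mixed Hessian
    is an invertible matrix [A], the vectors [p = x-x'] and [w = A(y-y')] thus
    almost satisfy [p . w <= 0], so that [|p - w|] controls [|p|] and [|w|]:
    on the support, the map [(x,y) |-> x - A y] to [R^d] is injective with
    Lipschitz inverse (Minty's trick, [local_twist]).  Cutting [R^d] into cubes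
    and using compactness, the support is cut into at most [C s^-d] pieces of
    diameter at most [s], for every [s <= 1] ([plan_support_covering]).

    Upper bound on [H(gamma)].  With [s = sqrt eps], replace the restriction of
    [gamma0] to each piece by the product of its marginals.  The change of cost
    is half the average of the mixed differences over pairs of points of a same
    piece ([shuffle_cost]), hence [O(s^2) = O(eps)].  The entropy of the new plan
    relative to [mu0 x mu1] is a mutual information carried by the index of the
    piece, hence at most the logarithm of the number of pieces
    ([exists_block_density], [entropy_upper_bound]).  Comparing [gamma] with this
    plan, and the cost of [gamma] with that of [gamma0], yields
    [H(gamma) <= (d/2) ln(1/eps) + O(1)] ([minimizer_entropy]).

    Lower bound on [H(gamma)].  If [gamma] is at distance at most [s] from
    [gamma0], Gibbs' inequality ([gibbs]) against the uniform mixture of the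
    Gaussians of width [s] centred in the pieces of size [s] gives
    [H(gamma) >= - ln(C s^-d) + 2d ln(1/s) - O(1) = d ln(1/s) - O(1)]
    ([entropy_lower_bound]).  If [s^2 = a eps] this is
    [(d/2) ln(1/eps) + (d/2) ln(1/a) - O(1)], where the [O(1)] does not depend on
    [a]; as [d > 0], it contradicts the upper bound once [a] is small. *)

(** * Measures with a density and entropy *)

Section measures.
Local Open Scope ereal_scope.
Context d (T : measurableType d) (R : realType).

Lemma exists_density_measure (mu : {measure set T -> \bar R}) (f : T -> R) :
  measurable_fun setT f -> (forall x, 0 <= f x)%R ->
  \int[mu]_x (f x)%:E < +oo ->
  exists nu : {finite_measure set T -> \bar R},
    forall A, measurable A -> nu A = \int[mu]_(x in A) (f x)%:E.
Proof.
move=> mf f0 fi.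
pose F (A : set T) := \int[mu]_(x in A) (f x)%:E.
have F0 : F set0 = 0 by rewrite /F integral_set0.
have Fge0 A : 0 <= F A by apply: integral_ge0 => x _; rewrite lee_fin.
have Fadd : semi_sigma_additive F.
  move=> G mG tG mUG; rewrite /F.
  rewrite [X in _ --> X]ge0_integral_bigcup//; first last.
  - by move=> x _; rewrite lee_fin.
  - by apply/measurable_EFinP; exact: measurable_funTS.
  apply: is_cvg_nneseries => n _ _; exact: Fge0.
have Ffin : fin_num_fun F.
  move=> A mA; rewrite ge0_fin_numE//; apply: le_lt_trans fi.
  apply: ge0_subset_integral => //; first exact/measurable_EFinP.
  by move=> x _; rewrite lee_fin.
pose m1 := isMeasure.Build _ T R F F0 Fge0 Fadd.
pose M : {measure set T -> \bar R} := HB.pack F m1.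
pose m2 := Measure_isFinite.Build _ T R M Ffin.
pose N : {finite_measure set T -> \bar R} := HB.pack F m1 m2.
by exists N.
Qed.

(** The density of [nu] agrees almost everywhere with the Radon-Nikodym
    derivative, for which the change of variables is known. *)
Lemma ge0_integral_density (mu : {sigma_finite_measure set T -> \bar R})
    (nu : {finite_measure set T -> \bar R}) (f : T -> R) (phi : T -> \bar R) :
  measurable_fun setT f -> (forall x, 0 <= f x)%R ->
  (forall A, measurable A -> nu A = \int[mu]_(x in A) (f x)%:E) ->
  measurable_fun setT phi -> (forall x, 0 <= phi x) ->
  \int[nu]_x phi x = \int[mu]_x (phi x * (f x)%:E).
Proof.
move=> mf f0 nuE mphi phi0.
have numu : nu `<< mu.
  apply/null_content_dominatesP => A mA muA; rewrite nuE//.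
  by apply: null_set_integral => //; apply/measurable_EFinP/measurable_funTS.
rewrite -(Radon_Nikodym_SigmaFinite.change_of_variables numu)//.
have mg : measurable_fun setT (Radon_Nikodym_SigmaFinite.f nu mu).
  exact: measurable_int (Radon_Nikodym_SigmaFinite.f_integrable numu).
apply: ae_eq_integral => //.
- exact: emeasurable_funM.
- by apply: emeasurable_funM => //; apply/measurable_EFinP.
- apply: ae_eqe_mul2l; apply: integral_ae_eq => //.
  + exact: Radon_Nikodym_SigmaFinite.f_integrable.
  + exact/measurable_EFinP.
  + move=> A _ mA; rewrite -nuE//.
    exact/esym/Radon_Nikodym_SigmaFinite.f_integral.
Qed.

Lemma exists_probability (mu : {measure set T -> \bar R}) :
  mu setT = 1 -> exists P : probability T R, forall A, P A = mu A.
Proof.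
move=> mu1.
pose F (A : set T) := mu A.
pose m1 := isMeasure.Build _ T R F (measure0 mu) (measure_ge0 mu)
  (@measure_semi_sigma_additive _ _ _ mu).
pose M : {measure set T -> \bar R} := HB.pack F m1.
pose m2 := Measure_isProbability.Build _ T R M mu1.
pose P : probability T R := HB.pack F m1 m2.
by exists P.
Qed.

Lemma integral_probability_cst (P : probability T R) (r : R) :
  \int[P]_x r%:E = r%:E.
Proof.
rewrite integral_cst//.
by rewrite (_ : _ setT = 1) ?mule1//; exact: probability_setT.
Qed.

(** Comparing positive and negative parts separately, the inequality survives
    infinite or undefined differences, so that entropies can be compared before they
    are known to be finite. *)
Lemma le_ae_integral (mu : {measure set T -> \bar R}) (f g : T -> \bar R) :
  measurable_fun setT f -> measurable_fun setT g ->
  {ae mu, forall x, f x <= g x} -> \int[mu]_x f x <= \int[mu]_x g x.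
Proof.
move=> mf mg fg; rewrite integralE [leRHS]integralE leeB//.
- apply: ae_ge0_le_integral => //; [exact: measurable_funepos..|].
  apply: filterS fg => x fgx _.
  by rewrite !funeposE ge_max !le_max fgx lexx orbT.
- apply: ae_ge0_le_integral => //; [exact: measurable_funeneg..|].
  apply: filterS fg => x fgx _.
  by rewrite !funenegE ge_max !le_max leeN2 fgx lexx orbT.
Qed.

Lemma density_gt0_ae (mu : {measure set T -> \bar R}) (P : probability T R) f :
  is_density mu P f -> {ae P, forall x, (0 < f x)%R}.
Proof.
move=> [mf f0 fE].
exists [set x | f x = 0]%R; split.
- rewrite [X in measurable X](_ : _ = setT `&` f @^-1` [set 0%R]); last by rewrite setTI.
  exact: mf.
- rewrite fE; first by rewrite integral0_eq// => x ->.
  rewrite [X in measurable X](_ : _ = setT `&` f @^-1` [set 0%R]); last by rewrite setTI.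
  exact: mf.
- move=> x /= /negP; rewrite -leNgt => fx; apply/eqP; by rewrite eq_le fx f0.
Qed.

(** Two densities agree almost everywhere for [mu], hence for [P]. *)
Lemma entropyE (mu : {measure set T -> \bar R}) (P : probability T R) f :
  is_density mu P f -> entropy mu P = \int[P]_x (ln (f x))%:E.
Proof.
move=> fd; have [mf f0 fE] := fd.
rewrite /entropy; case: pselect => [h|]; last by case; exists f.
case: cid => g /= gd; have [mg g0 gE] := gd.
apply: ae_eq_integral => //.
- by apply/measurable_EFinP; apply: measurableT_comp => //.
- by apply/measurable_EFinP; apply: measurableT_comp => //.
have Pmu : P `<< mu.
  apply/null_content_dominatesP => A mA muA; rewrite fE//.
  by apply: null_set_integral => //; apply/measurable_EFinP/measurable_funTS.
have [N [mN muN H]] : ae_eq mu setT (EFin \o g) (EFin \o f).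
  apply: integral_ae_eq => //.
  - apply/integrableP; split; first exact/measurable_EFinP.
    under eq_integral do rewrite /= ger0_norm//.
    by rewrite -gE// probability_setT ltry.
  - exact/measurable_EFinP.
  - by move=> A _ mA; rewrite -gE// -fE.
exists N; split => //.
  by move: Pmu => /null_content_dominatesP; apply.
move=> x /= Hx; apply: H => /= e; apply: Hx => _.
by congr EFin; congr ln; case: (e I).
Qed.

End measures.

(** * Conditional densities of a plan *)

Lemma exists_pushforward d d' (T : measurableType d) (T' : measurableType d')
    (R : realType) (nu : {finite_measure set T -> \bar R}) (X : T -> T') :
  measurable_fun setT X ->
  exists nu' : {finite_measure set T' -> \bar R},
    (forall B, nu' B = nu (X @^-1` B)) /\
    (forall phi : T' -> \bar R, measurable_fun setT phi ->
      (forall x, (0 <= phi x)%E) ->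
      (\int[nu']_x phi x = \int[nu]_z phi (X z))%E).
Proof.
move=> mX.
pose F (B : set T') := nu (X @^-1` B).
have mXB B : measurable B -> measurable (X @^-1` B).
  by move=> mB; rewrite -[X in measurable X]setTI; exact: mX.
have F0 : F set0 = 0%E by rewrite /F preimage_set0 measure0.
have Fge0 A : (0 <= F A)%E by exact: measure_ge0.
have Fadd : semi_sigma_additive F.
  move=> G mG tG mUG; rewrite /F preimage_bigcup.
  apply: measure_semi_sigma_additive; [by move=> n; exact: mXB| |].
  - apply/trivIsetP => /= i j _ _ ij; rewrite -preimage_setI.
    by move/trivIsetP : tG => /(_ _ _ _ _ ij) ->//; rewrite preimage_set0.
  - by rewrite -preimage_bigcup; exact: mXB.
have Ffin : fin_num_fun F by move=> A mA; apply: fin_num_measure; exact: mXB.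
pose m1 := isMeasure.Build _ T' R F F0 Fge0 Fadd.
pose M : {measure set T' -> \bar R} := HB.pack F m1.
pose m2 := Measure_isFinite.Build _ T' R M Ffin.
pose N : {finite_measure set T' -> \bar R} := HB.pack F m1 m2.
exists N; split => // phi mphi phi0.
rewrite -[RHS](@ge0_integral_pushforward _ _ _ _ _ _ mX nu setT phi)//.
Qed.

Section conditional_expectation.
Local Open Scope ereal_scope.
Context d d' (T : measurableType d) (T' : measurableType d') (R : realType).
Variables (P : probability T R) (X : T -> T') (mu : probability T' R).
Hypothesis mX : measurable_fun setT X.
Hypothesis XE : forall B, measurable B -> P (X @^-1` B) = mu B.

(** Radon-Nikodym derivative with respect to [mu] of the image under [X] of
    the measure of density [b]. *)
Lemma exists_conditional_density (b : T -> R) :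
  measurable_fun setT b -> (forall z, 0 <= b z <= 1)%R ->
  exists g : T' -> R, [/\ measurable_fun setT g, forall x, (0 <= g x)%R &
    forall phi, measurable_fun setT phi -> (forall x, 0 <= phi x) ->
      \int[P]_z (phi (X z) * (b z)%:E) = \int[mu]_x (phi x * (g x)%:E)].
Proof.
move=> mb b01; have b0 z : (0 <= b z)%R by have /andP[] := b01 z.
have [|nu nuE] := @exists_density_measure _ _ _ P b mb b0.
  apply: (@le_lt_trans _ _ (\int[P]_z 1)).
    apply: ge0_le_integral => //.
    + by move=> z _; rewrite lee_fin.
    + exact/measurable_EFinP.
    + by move=> z _; rewrite lee_fin; have /andP[] := b01 z.
  by rewrite integral_probability_cst ltry.
have [nu' [nu'E nu'I]] := @exists_pushforward _ _ _ _ _ nu X mX.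
have dom : nu' `<< mu.
  apply/null_content_dominatesP => B mB muB.
  have mXB : measurable (X @^-1` B).
    by rewrite -[X in measurable X]setTI; exact: mX.
  transitivity (nu (X @^-1` B)); first exact: nu'E.
  rewrite nuE//; apply: null_set_integral => //.
  - by apply/measurable_EFinP; exact: measurable_funTS.
  - exact: etrans (XE mB) muB.
have gfin := Radon_Nikodym_SigmaFinite.f_fin_num dom.
have g0 := Radon_Nikodym_SigmaFinite.f_ge0 dom.
have gint := Radon_Nikodym_SigmaFinite.f_integrable dom.
exists (fine \o Radon_Nikodym_SigmaFinite.f nu' mu); split.
- by apply: measurableT_comp => //; exact: measurable_int gint.
- by move=> x /=; apply: fine_ge0.
- move=> phi mphi phi0.
  under [RHS]eq_integral do rewrite /= fineK//.
  rewrite Radon_Nikodym_SigmaFinite.change_of_variables// nu'I//.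
  rewrite (ge0_integral_density mb b0 nuE)//.
  exact: measurableT_comp.
Qed.

(** The densities [g] and [h] associated with [b] and [1 - b] are nonnegative
    and of sum [1] almost everywhere, so that truncating [g] at [1] is harmless. *)
Lemma exists_conditional_expectation (b : T -> R) :
  measurable_fun setT b -> (forall z, 0 <= b z <= 1)%R ->
  exists g : T' -> R, [/\ measurable_fun setT g, forall x, (0 <= g x <= 1)%R &
    forall phi, measurable_fun setT phi -> (forall x, 0 <= phi x) ->
      \int[P]_z (phi (X z) * (b z)%:E) = \int[mu]_x (phi x * (g x)%:E)].
Proof.
move=> mb b01.
have [g [mg g0 gE]] := exists_conditional_density mb b01.
have mb' : measurable_fun setT (fun z => 1 - b z)%R by exact: measurable_funB.
have b01' z : (0 <= 1 - b z <= 1)%R.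
  by have := b01 z; lra.
have [h [mh h0 hE]] := exists_conditional_density mb' b01'.
have gh : ae_eq mu setT (fun x => (g x + h x)%:E) (cst 1).
  have ghE A : measurable A -> \int[mu]_(x in A) (g x + h x)%:E = mu A.
    move=> mA; rewrite -XE// integral_mkcond.
    pose phi x := (\1_A x)%:E : \bar R.
    have mphi : measurable_fun setT phi by apply/measurable_EFinP.
    have phi0 x : 0 <= phi x by rewrite lee_fin.
    transitivity (\int[mu]_x (phi x * (g x)%:E) + \int[mu]_x (phi x * (h x)%:E)).
      rewrite -ge0_integralD//; first last.
      - by apply: emeasurable_funM => //; apply/measurable_EFinP.
      - by move=> x _; rewrite mule_ge0// lee_fin.
      - by apply: emeasurable_funM => //; apply/measurable_EFinP.
      - by move=> x _; rewrite mule_ge0// lee_fin.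
      apply: eq_integral => x _; rewrite patchE /phi indicE.
      case: (boolP (x \in A)) => xA.
        by rewrite !mul1e EFinD.
      by rewrite !mul0e adde0.
    have mphiX : measurable_fun setT (phi \o X) by exact: measurableT_comp.
    rewrite -gE// -hE// -ge0_integralD//; first last.
    - apply: (@emeasurable_funM _ _ _ _ (phi \o X)) => //.
      exact/measurable_EFinP.
    - by move=> z _; rewrite mule_ge0// lee_fin; have /andP[] := b01' z.
    - apply: (@emeasurable_funM _ _ _ _ (phi \o X)) => //.
      exact/measurable_EFinP.
    - by move=> z _; rewrite mule_ge0// lee_fin; have /andP[] := b01 z.
    rewrite -[RHS]mul1e -integral_cst//; last first.
      by rewrite -[X in measurable X]setTI; exact: mX.
    rewrite [RHS]integral_mkcond; apply: eq_integral => z _.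
    rewrite patchE /phi indicE.
    rewrite (_ : (z \in _) = (X z \in A)); last by apply/idP/idP => /set_mem H; exact/mem_set.
    case: (boolP (X z \in A)) => xA; last by rewrite !mul0e adde0.
    by rewrite !mul1e -EFinD addrC subrK.
  have mgh : measurable_fun setT (fun x => (g x + h x)%:E).
    by apply/measurable_EFinP; exact: measurable_funD.
  apply: integral_ae_eq => //.
  - apply/integrableP; split => //.
    under eq_integral do rewrite /= ger0_norm ?addr_ge0//.
    by rewrite ghE// (_ : _ setT = 1) ?ltry//; exact: probability_setT.
  - by move=> A _ mA; rewrite ghE// integral_cst// mul1e.
(* By uniqueness of densities, [gh] makes [g] at most 1 almost everywhere. *)
exists (fun x => Num.min (g x) 1%R); split.
- exact: measurable_minr.
- by move=> x; rewrite le_min g0 ler01/= ge_min lexx orbT.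
- move=> phi mphi phi0; rewrite gE//; apply: ae_eq_integral => //.
  + by apply: emeasurable_funM => //; apply/measurable_EFinP.
  + by apply: emeasurable_funM => //; apply/measurable_EFinP; exact: measurable_minr.
  + apply: filterS gh => x /(_ I) [ghx] _; congr (_ * _%:E).
    by rewrite min_l//; have := h0 x; lra.
Qed.

End conditional_expectation.

(** * Symmetric exchanges of mass inside a plan *)

Section shuffle.
Local Open Scope ereal_scope.
Context d1 d2 (T1 : measurableType d1) (T2 : measurableType d2) (R : realType).
Variable g : probability (T1 * T2)%type R.
Local Notation Z := (T1 * T2)%type.
Variables (W : Z * Z -> R) (V : Z -> R).
Hypotheses (mW : measurable_fun setT W) (W0 : forall z, (0 <= W z)%R).
Hypotheses (mV : measurable_fun setT V) (V0 : forall z, (0 <= V z)%R).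
Hypothesis Wsym : forall z z', W (z, z') = W (z', z).
Hypothesis WV1 : forall z, \int[g]_z' (W (z, z'))%:E + (V z)%:E = 1.

(** Of two points of a plan, keep the first coordinate of one and the second
    coordinate of the other. *)
Definition exchange (p : Z * Z) : Z := (p.1.1, p.2.2).

(** Draw two independent points of [g] with weight [W] and exchange them; keep
    the remaining mass, of density [V], in place.  This covers both the exchange
    of mass between two regions and the shuffling of [g] inside the pieces of a
    partition. *)
Definition is_shuffle (g' : probability Z R) :=
  forall phi : Z -> \bar R, measurable_fun setT phi -> (forall z, 0 <= phi z) ->
  \int[g']_z phi z = \int[g \x g]_p (phi (exchange p) * (W p)%:E) +
                     \int[g]_z (phi z * (V z)%:E).

Lemma measurable_exchange : measurable_fun setT exchange.
Proof.
apply: measurable_fun_pair.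
- by apply: measurableT_comp => //; exact: measurableT_comp.
- by apply: measurableT_comp => //; exact: measurableT_comp.
Qed.

(** Conservation of mass [WV1] integrated against [phi]. *)
Lemma shuffle_integral1 (phi : Z -> \bar R) :
  measurable_fun setT phi -> (forall z, 0 <= phi z) ->
  \int[g \x g]_p (phi p.1 * (W p)%:E) + \int[g]_z (phi z * (V z)%:E) =
  \int[g]_z phi z.
Proof.
move=> mphi phi0.
have mWE : measurable_fun setT (EFin \o W) by exact/measurable_EFinP.
have mphi1 : measurable_fun setT (fun p : Z * Z => phi p.1 * (W p)%:E).
  apply: emeasurable_funM => //.
  exact: (measurableT_comp mphi measurable_fst).
have phi10 p : 0 <= phi p.1 * (W p)%:E by rewrite mule_ge0 ?lee_fin.
rewrite fubini_tonelli1//.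
rewrite -ge0_integralD//; first last.
- by apply: emeasurable_funM => //; apply/measurable_EFinP.
- by move=> z _; rewrite mule_ge0 ?lee_fin.
- exact: (@measurable_fun_fubini_tonelli_F _ _ _ _ R g (fun p : Z * Z => phi p.1 * (W p)%:E)).
- by move=> z _; apply: integral_ge0 => z' _; exact: phi10.
apply: eq_integral => z _; rewrite /fubini_F /=.
rewrite ge0_integralZl//; first last.
- by move=> z' _; rewrite lee_fin.
- by apply/measurable_EFinP; exact: measurableT_comp (pair1_measurable z).
by rewrite -ge0_muleDr ?WV1 ?mule1 ?lee_fin//; apply: integral_ge0 => z' _; rewrite lee_fin.
Qed.

Lemma shuffle_swap (f : Z * Z -> \bar R) :
  measurable_fun setT f -> (forall p, 0 <= f p) ->
  \int[g \x g]_p (f p * (W p)%:E) =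
  \int[g \x g]_p (f (p.2, p.1) * (W p)%:E).
Proof.
move=> mf f0.
have mWE : measurable_fun setT (EFin \o W) by exact/measurable_EFinP.
pose F (p : Z * Z) := f p * (W p)%:E.
pose G (p : Z * Z) := f (p.2, p.1) * (W p)%:E.
have mF : measurable_fun setT F by exact: emeasurable_funM.
have F0 p : 0 <= F p by rewrite mule_ge0 ?lee_fin.
have mG : measurable_fun setT G.
  apply: emeasurable_funM => //.
  exact: (measurableT_comp mf (@measurable_swap _ _ Z Z)).
have G0 p : 0 <= G p by rewrite mule_ge0 ?lee_fin.
rewrite [LHS](@fubini_tonelli1 _ _ _ _ _ g g F mF F0).
rewrite [RHS](@fubini_tonelli2 _ _ _ _ _ g g G mG G0).
apply: eq_integral => z _; apply: eq_integral => z' _.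
by rewrite /F /G /= Wsym.
Qed.

Lemma shuffle_integral2 (phi : Z -> \bar R) :
  measurable_fun setT phi -> (forall z, 0 <= phi z) ->
  \int[g \x g]_p (phi p.2 * (W p)%:E) + \int[g]_z (phi z * (V z)%:E) =
  \int[g]_z phi z.
Proof.
move=> mphi phi0; rewrite -[RHS]shuffle_integral1//; congr (_ + _).
rewrite [LHS](shuffle_swap (f := fun p => phi p.2))//.
exact: (measurableT_comp mphi measurable_snd).
Qed.

Lemma shuffle_mass : \int[g \x g]_p (W p)%:E + \int[g]_z (V z)%:E = 1.
Proof.
have H := @shuffle_integral1 (cst 1) (measurable_cst _) (fun _ => lee01).
rewrite -[RHS](integral_probability_cst g 1) -[RHS]H.
by congr (_ + _); apply: eq_integral => z _; rewrite mul1e.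
Qed.

Lemma shuffle_mass_le1 : \int[g \x g]_p (W p)%:E <= 1.
Proof.
rewrite -shuffle_mass leeDl// integral_ge0// => z _.
by rewrite lee_fin.
Qed.

Lemma exists_shuffle : exists g', is_shuffle g'.
Proof.
have W1 : \int[g \x g]_p (W p)%:E < +oo.
  exact: le_lt_trans shuffle_mass_le1 (ltry _).
have V1 : \int[g]_z (V z)%:E < +oo.
  apply: (@le_lt_trans _ _ (\int[g]_z 1%:E)); last first.
    by rewrite integral_probability_cst ltry.
  apply: ge0_le_integral => //.
  - by move=> z _; rewrite lee_fin.
  - exact/measurable_EFinP.
  - move=> z _; rewrite -(WV1 z) leeDr// integral_ge0// => z' _.
    by rewrite lee_fin.
have [n1 n1E] := exists_density_measure mW W0 W1.
have [n2 n2E] := exists_density_measure mV V0 V1.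
have [n3 [n3E n3I]] := exists_pushforward n1 measurable_exchange.
have n3W (phi : Z -> \bar R) : measurable_fun setT phi -> (forall z, 0 <= phi z) ->
    \int[n3]_z phi z = \int[g \x g]_p (phi (exchange p) * (W p)%:E).
  move=> mphi phi0; rewrite (n3I _ mphi phi0).
  have mpe : measurable_fun setT (phi \o exchange).
    exact: (measurableT_comp mphi measurable_exchange).
  pose gg : probability (Z * Z)%type R := (g \x g : set (Z * Z)%type -> \bar R).
  have n1E' A : measurable A -> n1 A = \int[gg]_(x in A) (W x)%:E := n1E A.
  have pe0 p : 0 <= (phi \o exchange) p by exact: phi0.
  have := @ge0_integral_density _ _ _ gg n1 W (phi \o exchange) mW W0 n1E' mpe pe0.
  by [].
have n2V (phi : Z -> \bar R) : measurable_fun setT phi -> (forall z, 0 <= phi z) ->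
    \int[n2]_z phi z = \int[g]_z (phi z * (V z)%:E).
  by move=> mphi phi0; exact: (ge0_integral_density mV V0 n2E mphi phi0).
have M1 : measure_add n3 n2 setT = 1.
  rewrite -[LHS]mul1e -integral_cst// ge0_integral_measure_add//=.
  rewrite n3W// n2V// -[RHS]shuffle_mass.
  by congr (_ + _); apply: eq_integral => z _; rewrite mul1e.
have [P PE] := exists_probability M1.
exists P => phi mphi phi0.
rewrite -n3W// -n2V// -ge0_integral_measure_add//.
by apply: eq_measure_integral => A mA _; exact: PE.
Qed.

Lemma probability_preimageE (P : probability Z R) d (T : measurableType d)
    (X : Z -> T) (A : set T) : measurable_fun setT X -> measurable A ->
  P (X @^-1` A) = \int[P]_z (\1_A (X z))%:E.
Proof.
move=> mX mA.
have mXA : measurable (X @^-1` A).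
  by rewrite -[X in measurable X]setTI; exact: mX.
transitivity (\int[P]_z (\1_(X @^-1` A) z)%:E); first by rewrite integral_indic// setIT.
by apply: eq_integral => z _; rewrite !indicE; congr (_%:R%:E).
Qed.

(** The exchange does not touch the first coordinate of the first point; the
    symmetry of [W] gives the same for the second coordinate of the second. *)
Lemma shuffle_coupling (mu : probability T1 R) (nu : probability T2 R) g' :
  is_shuffle g' -> coupling mu nu g -> coupling mu nu g'.
Proof.
move=> sh [gmu gnu]; split=> [A mA|B mB].
- rewrite -gmu// /pushforward.
  have mphi : measurable_fun setT (fun z : Z => (\1_A z.1)%:E : \bar R).
    by apply/measurable_EFinP; exact: measurableT_comp.
  have phi0 (z : Z) : 0 <= (\1_A z.1)%:E :> \bar R by rewrite lee_fin.
  rewrite [LHS]probability_preimageE// [RHS]probability_preimageE//.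
  rewrite sh//= -[RHS](shuffle_integral1 mphi phi0)//.
- rewrite -gnu// /pushforward.
  have mphi : measurable_fun setT (fun z : Z => (\1_B z.2)%:E : \bar R).
    by apply/measurable_EFinP; exact: measurableT_comp.
  have phi0 (z : Z) : 0 <= (\1_B z.2)%:E :> \bar R by rewrite lee_fin.
  rewrite [LHS]probability_preimageE// [RHS]probability_preimageE//.
  rewrite sh//= -[RHS](shuffle_integral2 mphi phi0)//.
Qed.

(** By the symmetry of [W], twice the new cost averages
    [c(x,y') + c(x',y)] while twice the old one averages [c(x,y) + c(x',y')].
    The constants [e1] and [e2] stand on either side to keep all integrands
    nonnegative, whatever the sign of the gain. *)
Lemma shuffle_cost g' (c : Z -> R) (e1 e2 : R) : is_shuffle g' ->
  measurable_fun setT c -> (forall z, 0 <= c z)%R -> (0 <= e1)%R -> (0 <= e2)%R ->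
  (forall z z', W (z, z') * (c (z.1, z'.2) + c (z'.1, z.2) + e1) <=
                W (z, z') * (c z + c z' + e2))%R ->
  \int[g']_z (c z)%:E + \int[g']_z (c z)%:E + e1%:E * \int[g \x g]_p (W p)%:E <=
  \int[g]_z (c z)%:E + \int[g]_z (c z)%:E + e2%:E * \int[g \x g]_p (W p)%:E.
Proof.
move=> sh mc c0 e10 e20 H.
have mWE : measurable_fun setT (fun p => (W p)%:E) by exact/measurable_EFinP.
have mcE : measurable_fun setT (fun z => (c z)%:E) by exact/measurable_EFinP.
have cE0 z : 0 <= (c z)%:E by rewrite lee_fin.
have WE0 z : 0 <= (W z)%:E by rewrite lee_fin.
have split3 (f1 f2 : Z * Z -> R) (e : R) :
    measurable_fun setT f1 -> measurable_fun setT f2 ->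
    (forall p, 0 <= f1 p)%R -> (forall p, 0 <= f2 p)%R -> (0 <= e)%R ->
    \int[g \x g]_p (W p * (f1 p + f2 p + e))%:E =
    \int[g \x g]_p ((f1 p)%:E * (W p)%:E) +
    \int[g \x g]_p ((f2 p)%:E * (W p)%:E) + e%:E * \int[g \x g]_p (W p)%:E.
  move=> mf1 mf2 f10 f20 e0.
  have m1 : measurable_fun setT (fun p => (f1 p)%:E * (W p)%:E).
    by apply: emeasurable_funM => //; exact/measurable_EFinP.
  have m2 : measurable_fun setT (fun p => (f2 p)%:E * (W p)%:E).
    by apply: emeasurable_funM => //; exact/measurable_EFinP.
  rewrite -ge0_integralZl// -ge0_integralD//; first last.
  - by move=> p _; rewrite mule_ge0 ?lee_fin.
  - by move=> p _; rewrite mule_ge0 ?lee_fin.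
  rewrite -ge0_integralD//; first last.
  - exact: emeasurable_funM.
  - by move=> p _; rewrite mule_ge0 ?lee_fin.
  - exact: emeasurable_funD.
  - by move=> p _; rewrite adde_ge0 ?mule_ge0 ?lee_fin.
  by apply: eq_integral => p _; rewrite -!EFinM -!EFinD; congr EFin; ring.
pose cx (p : Z * Z) := c (p.1.1, p.2.2).
pose cx' (p : Z * Z) := c (p.2.1, p.1.2).
have mcx : measurable_fun setT cx.
  by apply: (measurableT_comp mc); exact: measurable_exchange.
have mcx' : measurable_fun setT cx'.
  apply: (measurableT_comp mc); apply: measurable_fun_pair;
  by apply: measurableT_comp => //; exact: measurableT_comp.
have mc1 : measurable_fun setT (fun p : Z * Z => c p.1).
  exact: (measurableT_comp mc measurable_fst).
have mc2 : measurable_fun setT (fun p : Z * Z => c p.2).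
  exact: (measurableT_comp mc measurable_snd).
have key : \int[g \x g]_p (W p * (cx p + cx' p + e1))%:E <=
    \int[g \x g]_p (W p * (c p.1 + c p.2 + e2))%:E.
  apply: ge0_le_integral => //.
  - by move=> p _; rewrite lee_fin mulr_ge0 ?addr_ge0// /cx /cx'; exact: c0.
  - apply/measurable_EFinP; apply: (measurable_funM mW).
    exact: (measurable_funD (measurable_funD mcx mcx') (measurable_cst (e1 : R))).
  - apply/measurable_EFinP; apply: (measurable_funM mW).
    exact: (measurable_funD (measurable_funD mc1 mc2) (measurable_cst (e2 : R))).
  - by move=> [z z'] _; rewrite lee_fin; exact: H.
move: key; rewrite !split3//; try by move=> ?; exact: c0.
move=> key.
have Vc0 : 0 <= \int[g]_z ((c z)%:E * (V z)%:E).
  by apply: integral_ge0 => z _; rewrite mule_ge0 ?lee_fin.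
have swapE : \int[g \x g]_p ((cx p)%:E * (W p)%:E) =
    \int[g \x g]_p ((cx' p)%:E * (W p)%:E).
  have mcxE : measurable_fun setT (fun p => (cx p)%:E) by exact/measurable_EFinP.
  have cxE0 p : 0 <= (cx p)%:E by rewrite lee_fin /cx.
  exact: (shuffle_swap mcxE cxE0).
have E1 : \int[g']_z (c z)%:E = \int[g \x g]_p ((cx p)%:E * (W p)%:E) +
    \int[g]_z ((c z)%:E * (V z)%:E) := sh _ mcE cE0.
have E2 := shuffle_integral1 mcE cE0.
have E3 := shuffle_integral2 mcE cE0.
rewrite -swapE in key.
rewrite E1 -{1}E2 -E3.
set vc := \int[g]_z ((c z)%:E * (V z)%:E) in Vc0 *.
have r (a b e : \bar R) : a + vc + (b + vc) + e = (a + b + e) + (vc + vc).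
  by rewrite [X in X + e]addeACA [LHS]addeAC.
by rewrite !r leeD2r.
Qed.

End shuffle.

(** * Borel sets and support in the product space *)

Section support.
Context (R : realType) (n : nat).
Local Notation T := 'rV[R]_n.
Local Notation Z := (T * T)%type.

Definition rat_ball (p : 'rV[rat]_n * nat) : set T :=
  ball (map_mx ratr p.1 : T) p.2.+1%:R^-1.

Lemma rat_ball_basis (x : T) (e : R) : 0 < e ->
  exists p, rat_ball p x /\ rat_ball p `<=` ball x e.
Proof.
move=> e0; have := open_bigcup_rat_ball (ball_open x e).
move=> /(congr1 (fun A : set T => A x)) /=.
have bx : ball x e x by exact: ballxx.
by move=> H; move: bx; rewrite H => -[p /= pA px]; exists p.
Qed.

Lemma open_setX (A B : set T) : open A -> open B -> open (A `*` B : set Z).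
Proof.
move=> oA oB; rewrite (_ : A `*` B = fst @^-1` A `&` snd @^-1` B)//.
by apply: openI; apply: open_comp => // z _; [exact: cvg_fst|exact: cvg_snd].
Qed.

Lemma open_rat_ball p : open (rat_ball p).
Proof. exact: ball_open. Qed.

Definition rat_box (p : ('rV[rat]_n * nat) * ('rV[rat]_n * nat)) : set Z :=
  rat_ball p.1 `*` rat_ball p.2.

Lemma measurable_rat_box p : measurable (rat_box p).
Proof. by apply: measurableX; apply: open_measurable_mx; exact: open_rat_ball. Qed.

Lemma open_rat_box p : open (rat_box p).
Proof. by apply: open_setX; exact: open_rat_ball. Qed.

(** The rational boxes form a countable basis of the product topology. *)
Lemma rat_box_basis (z : Z) (U : set Z) : nbhs z U ->
  exists p, rat_box p z /\ rat_box p `<=` U.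
Proof.
move=> /nbhs_ballP[e /= e0 zU].
have [p [pz pe]] := rat_ball_basis z.1 e0.
have [q [qz qe]] := rat_ball_basis z.2 e0.
exists (p, q); split=> // w [/= w1 w2]; apply: zU.
by split; [exact: pe|exact: qe].
Qed.

Lemma measurable_bigcup_rat_box (A : set (('rV[rat]_n * nat) * ('rV[rat]_n * nat))) :
  measurable (\bigcup_(p in A) rat_box p).
Proof.
rewrite bigcup_mkcond; apply: countable_bigcupT_measurable => // p.
by case: ifPn => // _; exact: measurable_rat_box.
Qed.

(** The product of the two Borel sigma-algebras is the Borel sigma-algebra of
    the product because the topologies have countable bases. *)
Lemma open_measurable_prod (U : set Z) : open U -> measurable U.
Proof.
move=> oU; rewrite (_ : U = \bigcup_(p in [set p | rat_box p `<=` U]) rat_box p).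
  exact: measurable_bigcup_rat_box.
apply/seteqP; split=> [z Uz|z [p /= pU pz]]; last exact: pU.
have [|p [pz pU]] := @rat_box_basis z U; first exact: open_nbhs_nbhs.
by exists p.
Qed.

Lemma measurable_fun_continuous_on (A : set Z) (f : Z -> R) : open A ->
  (forall z, A z -> {for z, continuous f}) -> measurable_fun A f.
Proof.
move=> oA cf mA.
apply: (measurability _ (RGenOpens.measurableE R)) => // _ [_ [a [b ->]] <-].
apply: open_measurable_prod; rewrite openE => z [Az fz].
rewrite /interior; apply: filterI; first exact: open_nbhs_nbhs.
by apply: cf => //; apply: open_nbhs_nbhs; split => //; exact: interval_open.
Qed.

Lemma measurable_ball_prod (z : Z) (e : R) : 0 < e -> measurable (ball z e).
Proof. by move=> e0; apply: open_measurable_prod; exact: ball_open. Qed.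

(** The support, as [msupport] but in the product space. *)
Definition plan_support (g : set Z -> \bar R) : set Z :=
  [set z | forall U, open U -> U z -> (0 < g U)%E].

Lemma plan_supportE (g : {measure set Z -> \bar R}) :
  ~` plan_support g = \bigcup_(p in [set p | g (rat_box p) = 0%E]) rat_box p.
Proof.
apply/seteqP; split=> [z|z [p /= gp0 pz] /(_ _ (@open_rat_box p) pz)]; last first.
  by rewrite gp0 ltxx.
move=> /existsNP[U /not_implyP[oU /not_implyP[Uz /negP]]]; rewrite -leNgt => gU.
have [|p [pz pU]] := @rat_box_basis z U; first exact: open_nbhs_nbhs.
exists p => //=; apply/eqP; rewrite eq_le measure_ge0 andbT.
apply: le_trans gU; apply: le_measure => //; rewrite inE.
- exact: measurable_rat_box.
- exact: open_measurable_prod.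
Qed.

Lemma measurable_plan_support (g : {measure set Z -> \bar R}) :
  measurable (plan_support g).
Proof.
rewrite -[plan_support g]setCK plan_supportE; apply: measurableC.
exact: measurable_bigcup_rat_box.
Qed.

Lemma plan_support_full (g : {measure set Z -> \bar R}) :
  g (~` plan_support g) = 0%E.
Proof.
apply: measure_negligible.
  by apply: measurableC; exact: measurable_plan_support.
rewrite plan_supportE.
pose F k := if unpickle k is Some p then
  if g (rat_box p) == 0%E then rat_box p else set0 else set0.
apply: (@negligibleS _ _ _ _ (\bigcup_k F k)).
  move=> z [p /= gp0 pz]; exists (pickle p) => //.
  by rewrite /F pickleK gp0 eqxx.
apply: negligible_bigcup => k; rewrite /F.
case: unpickle => [p|]; last exact: negligible_set0.
case: ifPn => [/eqP gp0|_]; last exact: negligible_set0.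
by exists (rat_box p); split => //; exact: measurable_rat_box.
Qed.

End support.

(** * Second differences and the mixed Hessian *)

(** The increments of [f] along the line [w + s v] are those that define the
    derivative of [f] in the direction [v]. *)
Lemma is_derive_line (R : realType) (V : normedModType R) (f : V -> R)
    (w v : V) (t : R) : differentiable f (w + t *: v) ->
  is_derive t (1 : R) (fun s => f (w + s *: v)) ('D_v f (w + t *: v)).
Proof.
move=> df.
have dl : differentiable (fun s : R => w + s *: v) t by [].
have dfl : differentiable (fun s : R => f (w + s *: v)) t.
  exact: (differentiable_comp dl df).
apply: DeriveDef; first exact/derivable1_diffP.
have E : (fun h : R => h^-1 *: (((fun s : R => f (w + s *: v)) \o shift t) (h *: (1 : R)) -
    f (w + t *: v))) =
  (fun h : R => h^-1 *: ((f \o shift (w + t *: v)) (h *: v) - f (w + t *: v))).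
  apply/funext => h /=; rewrite [h%:A]mulr1 scalerDl addrA.
  by congr (h^-1 *: (f _ - _)); rewrite addrAC addrC addrA.
by rewrite /derive E.
Qed.

Section mixed_difference.
Context (R : realType) (n : nat).
Local Notation V := 'rV[R]_n.
Local Notation Z := (V * V)%type.

Lemma derive_sndE (f : Z -> R) (w : Z) (q : V) : differentiable f w ->
  'D_(0, q) f w = \sum_j q 0 j * 'D_(0, delta_mx 0 j) f w.
Proof.
move=> df; have -> : (0, q) = \sum_j q 0 j *: ((0, delta_mx 0 j) : Z).
  rewrite {1}(row_sum_delta q).
  elim/big_ind2 : _ => // [a u b v <- <-|j _].
    by rewrite [RHS](_ : _ = (0 + 0, u + v))// addr0.
  by rewrite [RHS](_ : _ = (q 0 j *: 0, q 0 j *: delta_mx 0 j))// scaler0.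
rewrite deriveE// linear_sum; apply: eq_bigr => j _.
by rewrite linearZ /= deriveE.
Qed.

Lemma derive_fstE (f : Z -> R) (w : Z) (p : V) : differentiable f w ->
  'D_(p, 0) f w = \sum_i p 0 i * 'D_(delta_mx 0 i, 0) f w.
Proof.
move=> df; have -> : (p, 0) = \sum_i p 0 i *: ((delta_mx 0 i, 0) : Z).
  rewrite {1}(row_sum_delta p).
  elim/big_ind2 : _ => // [a u b v <- <-|j _].
    by rewrite [RHS](_ : _ = (u + v, 0 + 0))// addr0.
  by rewrite [RHS](_ : _ = (p 0 j *: delta_mx 0 j, p 0 j *: 0))// scaler0.
rewrite deriveE// linear_sum; apply: eq_bigr => j _.
by rewrite linearZ /= deriveE.
Qed.

Lemma ball_segment (x0 x x' : V) (r s : R) : 0 <= s <= 1 ->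
  ball x0 r x -> ball x0 r x' -> ball x0 r (x' + s *: (x - x')).
Proof.
move=> s01; rewrite -!ball_normE /= => xr x'r.
have -> : x0 - (x' + s *: (x - x')) = (1 - s) *: (x0 - x') + s *: (x0 - x).
  apply/rowP => i; rewrite !mxE; ring.
apply: (le_lt_trans (ler_normD _ _)); rewrite !normrZ.
rewrite !ger0_norm; [|lra..].
have [s1|s1] := ltP s 1; last by nra.
by nra.
Qed.

(** The gain of cost when two points of a plan exchange their second
    coordinates. *)
Definition mixed_difference (c : Z -> R) (z z' : Z) : R :=
  c (z.1, z'.2) + c (z'.1, z.2) - c z - c z'.

(** The mean value theorem is applied twice: to the
    increment of [c] in [x], as a function of [y] moving from [y'] to [y], then to
    the partial derivative of [c] in the direction [y - y'], as a function of [x]. *)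
Lemma mixed_differenceE (Omega : set V) (c : Z -> R) (z0 z z' : Z) (r : R) :
  Ck_on 2 (Omega `*` Omega) c -> ball z0 r `<=` Omega `*` Omega ->
  ball z0 r z -> ball z0 r z' ->
  exists2 xi, ball z0 r xi &
    mixed_difference c z z' = - \sum_i \sum_j
      (z.1 - z'.1) 0 i * mixed_hessian c xi i j * (z.2 - z'.2) 0 j.
Proof.
case: z0 z z' => [x0 y0] [x y] [x' y'] [/= dc c1] sub [/= zx zy] [/= zx' zy'].
have {}c1 v w : (Omega `*` Omega) w -> differentiable (fun w => 'D_v c w) w.
  by move=> Ow; have [+ _] := c1 v; exact.
have s01 (s : R) : s \in `]0, 1[ -> 0 <= s <= 1.
  by rewrite in_itv/= => /andP[/ltW -> /ltW ->].
set p := x - x'; set q := y - y'.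
pose h (s : R) := c ((x, y') + s *: (0, q)) - c ((x', y') + s *: (0, q)).
pose dh (s : R) := 'D_(0, q) c ((x, y') + s *: (0, q))
                   - 'D_(0, q) c ((x', y') + s *: (0, q)).
have linE u (s : R) : (u, y') + s *: (0, q) = (u, y' + s *: q) :> Z.
  by rewrite [LHS](_ : _ = (u + s *: 0, y' + s *: q))// scaler0 addr0.
have linE' v (s : R) : (x', v) + s *: (p, 0) = (x' + s *: p, v) :> Z.
  by rewrite [LHS](_ : _ = (x' + s *: p, v + s *: 0))// scaler0 addr0.
have inball (s : R) u : 0 <= s <= 1 -> ball x0 r u ->
    ball (x0, y0) r ((u, y') + s *: (0, q)).
  by move=> s1 ur; rewrite linE; split => //=; exact: ball_segment.
have dh_ (s : R) : 0 <= s <= 1 -> is_derive s (1 : R) h (dh s).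
  move=> s1; apply: is_deriveB; apply: is_derive_line; apply: dc; apply: sub;
  exact: inball.
have [||s s1] := @MVT R h dh 0 1 ltr01.
- by move=> s /s01; exact: dh_.
- apply: derivable_within_continuous => s; rewrite in_itv/= => s1.
  by have [] := dh_ s s1.
rewrite subr0 mulr1 => hE.
have {}s1 := s01 _ s1; set eta := y' + s *: q in hE.
have etaY : ball y0 r eta by exact: ball_segment.
(* At the end points this is the derivative of [c] in the direction (0, q);
   the expansion on the basis makes its own derivative a sum of entries of the
   mixed Hessian. *)
pose k (t : R) := \sum_j q 0 j * 'D_(0, delta_mx 0 j) c ((x', eta) + t *: (p, 0)).
pose dk (t : R) := \sum_j q 0 j *:
  'D_(p, 0) (fun w => 'D_(0, delta_mx 0 j) c w) ((x', eta) + t *: (p, 0)).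
have inball' (t : R) : 0 <= t <= 1 -> ball (x0, y0) r ((x', eta) + t *: (p, 0)).
  by move=> t1; rewrite linE'; split => //=; exact: ball_segment.
have dk_ (t : R) : 0 <= t <= 1 -> is_derive t (1 : R) k (dk t).
  move=> t1.
  have -> : k = \sum_j (fun t : R => q 0 j *:
      'D_(0, delta_mx 0 j) c ((x', eta) + t *: (p, 0))).
    by apply/funext => u; rewrite fct_sumE.
  apply: is_derive_sum => j; apply: is_deriveZ; apply: is_derive_line.
  by apply: c1; apply: sub; exact: inball'.
have [||t t1] := @MVT R k dk 0 1 ltr01.
- by move=> t /s01; exact: dk_.
- apply: derivable_within_continuous => t; rewrite in_itv/= => t1.
  by have [] := dk_ t t1.
rewrite subr0 mulr1 => kE.
have {}t1 := s01 _ t1.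
exists ((x', eta) + t *: (p, 0)); first exact: inball'.
have dhk : dh s = k 1 - k 0.
  rewrite /dh /k !linE -/eta !linE' scale1r scale0r addr0.
  have xE : x' + p = x by rewrite /p addrC subrK.
  rewrite xE !derive_sndE//; apply: dc; apply: sub; split => //=.
rewrite /mixed_difference /=.
have -> : c (x, y') + c (x', y) - c (x, y) - c (x', y') = - (h 1 - h 0).
  rewrite /h !scale1r !scale0r !addr0.
  have yE u : ((u, y') + (0, q) : Z) = (u, y).
    by rewrite [LHS](_ : _ = (u + 0, y' + q))// addr0 /q addrC subrK.
  rewrite !yE; ring.
rewrite hE dhk kE /dk; congr (- _); rewrite exchange_big /=.
apply: eq_bigr => j _; rewrite derive_fstE; last by apply: c1; apply: sub; exact: inball'.
rewrite scaler_sumr; apply: eq_bigr => i _.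
rewrite [mixed_hessian _ _ _ _]mxE; exact: mulrC.
Qed.

End mixed_difference.

(** * Minty's change of variables *)

Section row_norm.
Context (R : realType) (n : nat).
Implicit Types (v w p q : 'rV[R]_n) (A M : 'M[R]_n).

Lemma ler_coord_norm v i : `|v 0 i| <= `|v|.
Proof.
rewrite [leRHS]/Num.norm/= mx_normrE.
exact: (le_bigmax _ (fun ij : 'I_1 * 'I_n => `|v ij.1 ij.2|) (0, i)).
Qed.

Lemma ler_row_norm v (b : R) : 0 <= b -> (forall i, `|v 0 i| <= b) -> `|v| <= b.
Proof.
move=> b0 vb; rewrite [leLHS]/Num.norm/= mx_normrE.
by apply: bigmax_le => // -[i j] _; rewrite (ord1 i).
Qed.

Lemma row_mulmx_bound A : exists2 K : R, 0 <= K &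
  forall w, `|w *m A| <= K * `|w|.
Proof.
exists (\sum_i \sum_j `|A i j|).
  by apply: sumr_ge0 => i _; apply: sumr_ge0.
move=> w; apply: ler_row_norm.
  by rewrite mulr_ge0//; apply: sumr_ge0 => i _; apply: sumr_ge0.
move=> j; rewrite mxE; apply: le_trans (ler_norm_sum _ _ _) _.
rewrite mulr_suml; apply: ler_sum => i _; rewrite normrM mulrC.
apply: ler_pM => //; last exact: ler_coord_norm.
by rewrite (bigD1 j)//= lerDl sumr_ge0.
Qed.

Lemma bilinear_bound A (e : R) p q : 0 <= e -> (forall i j, `|A i j| <= e) ->
  \sum_i \sum_j p 0 i * A i j * q 0 j <= e * n%:R ^+ 2 * `|p| * `|q|.
Proof.
move=> e0 Ae; apply: (@le_trans _ _ (\sum_(i < n) \sum_(j < n) e * `|p| * `|q|)).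
  apply: ler_sum => i _; apply: ler_sum => j _.
  apply: le_trans (ler_norm _) _; rewrite !normrM.
  apply: ler_pM => //; last exact: ler_coord_norm.
  by rewrite mulrC; apply: ler_pM => //; exact: ler_coord_norm.
rewrite !sumr_const !card_ord -mulr_natr -[leLHS]mulr_natr; lra.
Qed.

Lemma sqr_norm_le_sum v : `|v| ^+ 2 <= \sum_i v 0 i ^+ 2.
Proof.
have s0 : 0 <= \sum_i v 0 i ^+ 2 by apply: sumr_ge0 => i _; exact: sqr_ge0.
rewrite -(sqr_sqrtr s0) ler_pXn2r ?nnegrE ?sqrtr_ge0//.
apply: ler_row_norm => [|i]; first exact: sqrtr_ge0.
rewrite -(sqrtr_sqr (v 0 i)) ler_wsqrtr// (bigD1 i)//= lerDl.
by apply: sumr_ge0 => j _; exact: sqr_ge0.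
Qed.

Lemma sum_sqr_le_norm v : \sum_i v 0 i ^+ 2 <= n%:R * `|v| ^+ 2.
Proof.
apply: (@le_trans _ _ (\sum_(i < n) `|v| ^+ 2)).
  apply: ler_sum => i _; rewrite -(real_normK (num_real (v 0 i))).
  by rewrite ler_pXn2r ?nnegrE//; exact: ler_coord_norm.
by rewrite sumr_const card_ord mulr_natl.
Qed.

Lemma mx_subE (m k : nat) (A M : 'M[R]_(m, k)) i j : (A - M) i j = A i j - M i j.
Proof. by rewrite !mxE. Qed.

(** Minty's trick.  With [w = q A^T], the monotonicity of [M] and the
    closeness of [M] to [A] give [2 p . w <= |p| |w|], so that
    [|p - w|^2 >= |p|^2 + |w|^2 - |p| |w|] bounds both [|p|] and [|w|].  The factors
    [n] come from the comparison of the sup norm with the Euclidean one. *)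
Lemma minty_bound A M (K e : R) p q : 0 <= K -> 0 <= e ->
  A \in unitmx -> (forall w, `|w *m invmx A^T| <= K * `|w|) ->
  (forall i j, `|(A - M) i j| <= e) -> 2 * (e * n%:R ^+ 2 * K) <= 1 ->
  0 <= - \sum_i \sum_j p 0 i * M i j * q 0 j ->
  `|p| <= (2 * n%:R + 1) * `|p - q *m A^T| /\
  `|q| <= K * ((2 * n%:R + 1) * `|p - q *m A^T|).
Proof.
move=> K0 e0 uA AK AM eK H.
pose w := q *m A^T; set u := p - _.
have qw : q = w *m invmx A^T by rewrite /w -mulmxA mulmxV ?unitmx_tr// mulmx1.
have qK : `|q| <= K * `|w| by rewrite {1}qw.
have pw : \sum_i p 0 i * w 0 i <= e * n%:R ^+ 2 * `|p| * `|q|.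
  apply: le_trans (bilinear_bound p q e0 AM).
  rewrite -subr_ge0 -sumrB; move: H; rewrite -sumrN => /le_trans; apply.
  apply: ler_sum => i _; rewrite /w mxE mulr_sumr -sumrB -sumrN.
  apply: ler_sum => j _; rewrite !mxE; lra.
have pw2 : 2 * \sum_i p 0 i * w 0 i <= `|p| * `|w|.
  have h1 : e * n%:R ^+ 2 * `|p| * `|q| <= e * n%:R ^+ 2 * `|p| * (K * `|w|).
    by rewrite ler_wpM2l// !mulr_ge0.
  have h2 : 2 * (e * n%:R ^+ 2 * K) * (`|p| * `|w|) <= 1 * (`|p| * `|w|).
    by rewrite ler_wpM2r// mulr_ge0.
  lra.
have sumE : \sum_i u 0 i ^+ 2 =
    \sum_i p 0 i ^+ 2 + \sum_i w 0 i ^+ 2 - 2 * \sum_i p 0 i * w 0 i.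
  rewrite mulr_sumr -big_split -sumrB /=; apply: eq_bigr => i _.
  rewrite /u !mxE -/w; rewrite (_ : \sum_j _ = w 0 i); last by rewrite mxE.
  ring.
have hu := sum_sqr_le_norm u.
have hp := sqr_norm_le_sum p.
have hw := sqr_norm_le_sum w.
have p0 : 0 <= `|p| by [].
have w0 : 0 <= `|w| by [].
have u0 : 0 <= `|u| by [].
have n0 : 0 <= n%:R :> R by [].
have tot : `|p| ^+ 2 + `|w| ^+ 2 <= 2 * n%:R * `|u| ^+ 2 by have := sqr_ge0 (`|p| - `|w|); lra.
have main (a : R) : 0 <= a -> a ^+ 2 <= 2 * n%:R * `|u| ^+ 2 ->
    a <= (2 * n%:R + 1) * `|u|.
  move=> a0 ha; rewrite -(@ler_pXn2r _ 2) ?nnegrE ?mulr_ge0 ?addr_ge0 ?mulr_ge0//.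
  apply: (le_trans ha); rewrite exprMn ler_wpM2r ?sqr_ge0//; nra.
have pu : `|p| <= (2 * n%:R + 1) * `|u|.
  by apply: main => //; have := sqr_ge0 `|w|; lra.
split=> //; apply: (le_trans qK); rewrite ler_wpM2l//.
by apply: main => //; have := sqr_ge0 `|p|; lra.
Qed.

End row_norm.

Section local_twist.
Context (R : realType) (n : nat).
Local Notation V := 'rV[R]_n.
Local Notation Z := (V * V)%type.
Variables (Omega : set V) (c : Z -> R).
Hypotheses (oO : open Omega) (C2 : Ck_on 2 (Omega `*` Omega) c).

Lemma continuous_mixed_hessian z i j : (Omega `*` Omega) z ->
  {for z, continuous (fun w => mixed_hessian c w i j)}.
Proof.
move=> Oz; have [_ /(_ (0, delta_mx 0 j)) [_ /(_ (delta_mx 0 i, 0)) /(_ z Oz)]] := C2.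
rewrite (_ : (fun w => mixed_hessian c w i j) =
  (fun w => 'D_(delta_mx 0 i, 0) (fun w => 'D_(0, delta_mx 0 j) c w) w))//.
by apply/funext => w; rewrite mxE.
Qed.

(** The coordinate of Minty's parametrization: a set on which the mixed
    difference is nonnegative is locally a Lipschitz graph over it. *)
Definition twist_map (A : 'M[R]_n) (z : Z) : V := z.1 - z.2 *m A^T.

(** The radius is such that the mixed Hessian varies by at most [e] on the ball,
    with [e] small enough for [minty_bound]; the first estimate holds for all
    pairs of points, the second one for those in monotone position. *)
Lemma local_twist z0 : (Omega `*` Omega) z0 -> mixed_hessian c z0 \in unitmx ->
  exists r C : R, [/\ 0 < r, 0 < C, ball z0 r `<=` Omega `*` Omega &
    forall z z', ball z0 r z -> ball z0 r z' ->
      mixed_difference c z z' <= C * `|z - z'| ^+ 2 /\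
      (0 <= mixed_difference c z z' ->
       `|z - z'| <= C * `|twist_map (mixed_hessian c z0) z -
                         twist_map (mixed_hessian c z0) z'|)].
Proof.
move=> Oz0; have [A AE] : exists A, mixed_hessian c z0 = A by exists (mixed_hessian c z0).
rewrite AE => uA.
have [K K0 AK] := row_mulmx_bound (invmx A^T).
(* The variation of the Hessian that [minty_bound] tolerates. *)
pose e : R := (2 * n%:R ^+ 2 * K + 1)^-1.
have D0 : 0 < 2 * n%:R ^+ 2 * K + 1 by rewrite ltr_wpDl// !mulr_ge0.
have e0 : 0 < e by rewrite invr_gt0.
have : \forall z \near z0, (Omega `*` Omega) z /\
    forall ij : 'I_n * 'I_n, `|(A - mixed_hessian c z) ij.1 ij.2| <= e.
  apply: filterI; first by apply: open_nbhs_nbhs; split => //; exact: open_setX.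
  apply: (@filter_forall Z ('I_n * 'I_n)%type (fun ij z =>
    `|(A - mixed_hessian c z) ij.1 ij.2| <= e) (nbhs z0)) => -[i j] /=.
  have /cvgrPdist_le /(_ e e0) := @continuous_mixed_hessian z0 i j Oz0.
  rewrite AE; by apply: filterS => z; rewrite mx_subE.
move=> /nbhs_ballP[r /= r0 zr].
pose B := \sum_i \sum_j (`|A i j| + e).
have B0 : 0 <= B by apply: sumr_ge0 => i _; apply: sumr_ge0 => j _; rewrite addr_ge0// ltW.
have C10 : 0 <= (1 + K) * (2 * n%:R + 1) :> R by rewrite mulr_ge0// addr_ge0// mulr_ge0.
have nn0 : 0 <= n%:R :> R by [].
exists r, (1 + B + (1 + K) * (2 * n%:R + 1)); split => //.
- by rewrite -addrA ltr_pwDl// addr_ge0.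
- by move=> z /zr [].
move=> z z' zz zz'.
have sub : ball z0 r `<=` Omega `*` Omega by move=> w /zr [].
have [xi xir mdE] := mixed_differenceE C2 sub zz zz'.
have [_ Mxi] := zr _ xir.
have pz : `|z.1 - z'.1| <= `|z - z'| by rewrite [leRHS]prod_normE le_max lexx.
have qz : `|z.2 - z'.2| <= `|z - z'| by rewrite [leRHS]prod_normE le_max lexx orbT.
split.
  apply: (@le_trans _ _ (B * `|z - z'| ^+ 2)); last first.
    by rewrite ler_wpM2r ?sqr_ge0//; lra.
  rewrite mdE -sumrN mulr_suml; apply: ler_sum => i _.
  rewrite -sumrN mulr_suml; apply: ler_sum => j _.
  apply: le_trans (ler_norm _) _; rewrite normrN !normrM.
  have Mb : `|mixed_hessian c xi i j| <= `|A i j| + e.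
    have := Mxi (i, j) => /=; rewrite mx_subE.
    move: (mixed_hessian c xi i j) => m h.
    have -> : m = A i j - (A i j - m) by rewrite opprB addrC subrK.
    by apply: le_trans (ler_normB _ _) _; rewrite lerD2l.
  have h1 := le_trans (ler_coord_norm (z.1 - z'.1) i) pz.
  have h2 := le_trans (ler_coord_norm (z.2 - z'.2) j) qz.
  rewrite [leRHS](_ : _ = `|z - z'| * (`|A i j| + e) * `|z - z'|); last by ring.
  by rewrite ler_pM// ?mulr_ge0// ler_pM.
move=> md0; rewrite mdE in md0.
have AM i j : `|(A - mixed_hessian c xi) i j| <= e by exact: (Mxi (i, j)).
have eK : 2 * (e * n%:R ^+ 2 * K) <= 1.
  have eD : e * (2 * n%:R ^+ 2 * K + 1) = 1 by rewrite mulVf// gt_eqF.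
  by move: eD e0; lra.
have [h1 h2] := minty_bound K0 (ltW e0) uA AK AM eK md0.
have uE : twist_map A z - twist_map A z' =
    (z.1 - z'.1) - (z.2 - z'.2) *m A^T.
  rewrite /twist_map mulmxBl; move: (z.2 *m A^T) (z'.2 *m A^T) => a b.
  by apply/rowP => i; rewrite !mxE; ring.
move: h1 h2; rewrite -uE; move: (twist_map A z - _) => v; set u := `|v| => h1 h2.
have u0 : 0 <= u by exact: normr_ge0.
have nu0 : 0 <= (2 * n%:R + 1) * u by rewrite mulr_ge0// addr_ge0// mulr_ge0.
have Knu0 : 0 <= K * ((2 * n%:R + 1) * u) by rewrite mulr_ge0.
apply: (@le_trans _ _ ((1 + K) * (2 * n%:R + 1) * u)); last first.
  by rewrite ler_wpM2r//; lra.
rewrite [leLHS]prod_normE ge_max; apply/andP; split.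
  by apply: (le_trans h1); lra.
by apply: (le_trans h2); lra.
Qed.

End local_twist.

(** * Coverings of d-dimensional sets at scale s *)

Section covering.
Context (R : realType) (n : nat).
Local Notation V := 'rV[R]_n.
Local Notation Z := (V * V)%type.
Variables (Omega : set V) (c : Z -> R) (S : set Z).
Hypotheses (oO : open Omega) (C2 : Ck_on 2 (Omega `*` Omega) c).
Hypotheses (tw : inf_twisted Omega c) (mS : measurable S).
Hypothesis monoS : forall z z', S z -> S z' -> 0 <= mixed_difference c z z'.

(** The second clause about pieces holds as soon as they have diameter [delta]
    and lie in a common ball on which the mixed Hessian is bounded. *)
Definition fine_covering (C delta : R) (E : set Z) (I : finType) (F : I -> set Z) :=
  [/\ #|I|%:R * delta ^+ n <= C, forall i, measurable (F i),
      E `<=` \bigcup_i F i &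
      forall i z z', F i z -> F i z' ->
        `|z - z'| <= delta /\ mixed_difference c z z' <= C * delta ^+ 2].

(** Each point is given to the first piece that contains it. *)
Lemma fine_covering_disjoint C delta E (I : finType) (F : I -> set Z) :
  fine_covering C delta E F -> exists2 G : I -> set Z,
    fine_covering C delta E G & forall i j z, G i z -> G j z -> i = j.
Proof.
move=> [h1 mF EF h4].
pose G i := F i `\` \bigcup_(j in [set j | (enum_rank j < enum_rank i)%N]) F j.
exists G.
  split => //.
  - move=> i; apply: measurableD => //; apply: fin_bigcup_measurable => //.
  - move=> z /EF[i0 _ Fi0].
    have P0 : `[< F i0 z >] by exact/asboolP.
    case: (@arg_minnP I i0 (fun i => `[< F i z >]) (fun i => enum_rank i) P0) => i /asboolP Fi imin.
    exists i => //; split => // -[j /= ji /asboolP Fj].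
    by have := imin j Fj; rewrite leqNgt ji.
  - by move=> i z z' [Fz _] [Fz' _]; exact: h4 Fz Fz'.
move=> i j z [Fi Gi] [Fj Gj]; apply/enum_rank_inj/val_inj/eqP.
rewrite eqn_leq; apply/andP; split; rewrite leqNgt; apply/negP => ij.
  by apply: Gi; exists j.
by apply: Gj; exists i.
Qed.

(** The upper box dimension of [E] is at most [n], by pieces that are
    moreover adapted to the cost. *)
Definition small_dimension (E : set Z) := exists C : R,
  forall delta, 0 < delta <= 1 -> exists (I : finType) (F : I -> set Z),
    fine_covering C delta E F.

Lemma fine_covering_le C C' delta E (I : finType) (F : I -> set Z) : C <= C' ->
  fine_covering C delta E F -> fine_covering C' delta E F.
Proof.
move=> CC [h1 h2 h3 h4]; split => //; first exact: le_trans CC.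
move=> i z z' Fz Fz'; have [? h] := h4 i z z' Fz Fz'; split => //.
by apply: (le_trans h); rewrite ler_wpM2r// sqr_ge0.
Qed.

Lemma small_dimension0 : small_dimension set0.
Proof.
exists 0 => delta _; exists void, (fun _ => set0); split => //.
by rewrite card_void mul0r.
Qed.

Lemma small_dimensionU E1 E2 :
  small_dimension E1 -> small_dimension E2 -> small_dimension (E1 `|` E2).
Proof.
move=> [C1 h1] [C2' h2]; exists (Num.max 0 C1 + Num.max 0 C2') => delta d01.
have [I1 [F1 f1]] := h1 _ d01; have [I2 [F2 f2]] := h2 _ d01.
have m1 : C1 <= Num.max 0 C1 by rewrite le_max lexx orbT.
have m2 : C2' <= Num.max 0 C2' by rewrite le_max lexx orbT.
have m10 : 0 <= Num.max 0 C1 by rewrite le_max lexx.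
have m20 : 0 <= Num.max 0 C2' by rewrite le_max lexx.
have [a1 b1 s1 g1] := fine_covering_le m1 f1.
have [a2 b2 s2 g2] := fine_covering_le m2 f2.
exists (I1 + I2)%type, (fun i => match i with inl j => F1 j | inr j => F2 j end).
split.
- by rewrite card_sum natrD mulrDl lerD.
- by case.
- move=> z [/s1[i _ Fi]|/s2[i _ Fi]]; first by exists (inl i).
  by exists (inr i).
- have d0 := sqr_ge0 delta.
  move=> [i|i] z z' Fz Fz'.
    by have [? h] := g1 i z z' Fz Fz'; split => //; apply: (le_trans h); nra.
  by have [? h] := g2 i z z' Fz Fz'; split => //; apply: (le_trans h); nra.
Qed.

Lemma small_dimension_sub E1 E2 :
  E1 `<=` E2 -> small_dimension E2 -> small_dimension E1.
Proof.
move=> sub [C h]; exists C => delta /h [I [F [h1 h2 h3 h4]]].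
by exists I, F; split => //; exact: subset_trans h3.
Qed.

(** The sets that contain some [E0] with [small_dimension (S `&` E0)] form a
    filter, and near-covering compactness applied to it spares the extraction of a
    finite subcover. *)
Lemma small_dimension_compact (K : set Z) : compact K ->
  (forall z, K z -> exists2 U, open U /\ U z & small_dimension (S `&` U)) ->
  small_dimension (S `&` K).
Proof.
move=> /compact_near_coveringP cK loc.
(* The filter of the sets that contain a set of small dimension. *)
pose F : set_system (set Z) := [set Us | exists2 E0,
  small_dimension (S `&` E0) & forall E, E0 `<=` E -> Us E].
have FF : Filter F.
  split.
  - by exists set0 => //; rewrite setI0; exact: small_dimension0.
  - move=> Us Vs [E1 s1 h1] [E2 s2 h2]; exists (E1 `|` E2).
      by rewrite setIUr; exact: small_dimensionU.
    move=> E E12; split; [apply: h1|apply: h2]; apply: subset_trans E12;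
    [exact: subsetUl|exact: subsetUr].
  - by move=> Us Vs UV [E0 s0 h0]; exists E0 => // E /h0 /UV.
have [|E0 s0 /(_ E0 (@subset_refl _ _)) KE0] := cK _ F (fun E z => E z) FF.
- move=> z /loc [U [oU Uz] sU].
  exists (U, [set E | U `<=` E]) => /=; last by move=> [w E] [/= Uw]; exact.
  by split; [exact: open_nbhs_nbhs|exists U].
- by apply: small_dimension_sub s0; exact: setIS.
Qed.

Lemma measurable_twist_map (A : 'M[R]_n) i :
  measurable_fun setT (fun z : Z => twist_map A z 0 i).
Proof.
rewrite (_ : (fun _ => _) = (fun z : Z => z.1 0 i - \sum_j z.2 0 j * A i j)); last first.
  apply/funext => z; rewrite /twist_map !mxE; congr (_ - _).
  by apply: eq_bigr => j _; rewrite mxE.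
apply: measurable_funB.
  exact: (measurableT_comp (measurable_fun_coord _ _) measurable_fst).
apply: measurable_sum => j; apply: measurable_funM => //.
exact: (measurableT_comp (measurable_fun_coord _ _) measurable_snd).
Qed.

(** The pieces are the preimages of the cubes of a grid of mesh [delta / C]
    under [twist_map], whose inverse is Lipschitz on [S]. *)
Lemma small_dimension_local z0 : (Omega `*` Omega) z0 ->
  exists2 U, open U /\ U z0 & small_dimension (S `&` U).
Proof.
move=> Oz0; have [r [C [r0 C0 sub H]]] := local_twist oO C2 Oz0 (tw Oz0).
move: H; move: (mixed_hessian c z0) => A H.
exists (ball z0 r); first by split; [exact: ball_open|exact: ballxx].
pose u z i := twist_map A z 0 i.
have [K K0 AK] := row_mulmx_bound A^T.
pose L := (1 + K) * r.
have L0 : 0 <= L by rewrite mulr_ge0 ?addr_ge0// ltW.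
have uL z i : ball z0 r z -> `|u z i - u z0 i| <= L.
  rewrite -ball_normE /= distrC prod_normE gt_max => /andP[h1 h2].
  rewrite /u -mx_subE; apply: (le_trans (ler_coord_norm _ i)).
  have -> : twist_map A z - twist_map A z0 = (z - z0).1 - (z - z0).2 *m A^T.
    rewrite /twist_map mulmxBl; move: (z.2 *m A^T) (z0.2 *m A^T) => a b.
    by apply/rowP => k; rewrite !mxE; ring.
  apply: (le_trans (ler_normB _ _)); rewrite /L mulrDl mul1r lerD//; first exact: ltW.
  by apply: (le_trans (AK _)); rewrite ler_wpM2l// ltW.
exists (C + (2 * L * C + 1) ^+ n) => d /andP[d0 d1].
pose e := d / C.
have e0 : 0 < e by rewrite divr_gt0.
pose M := (Num.truncn (2 * L / e)).+1.
pose cell (k : {ffun 'I_n -> 'I_M}) := [set z : Z | forall i,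
  (k i)%:R * e <= u z i - u z0 i + L < (k i).+1%:R * e].
exists {ffun 'I_n -> 'I_M}, (fun k => S `&` ball z0 r `&` cell k).
have LL0 : 0 <= 2 * L by rewrite mulr_ge0.
have LC0 : 0 <= 2 * L * C by rewrite mulr_ge0// ltW.
have tC0 : 0 <= (2 * L * C + 1) ^+ n.
  by rewrite exprn_ge0// addr_ge0.
split.
- rewrite card_ffun !card_ord natrX -exprMn.
  apply: (@le_trans _ _ ((2 * L * C + 1) ^+ n)); last by lra.
  apply: lerXn2r; rewrite ?nnegrE.
  + by rewrite mulr_ge0// ltW.
  + by rewrite addr_ge0.
  have h : (Num.truncn (2 * L / e))%:R <= 2 * L / e.
    by rewrite truncn_le divr_ge0// ltW.
  have h2 : (Num.truncn (2 * L / e))%:R * d <= 2 * L / e * d.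
    by rewrite ler_wpM2r// ltW.
  have h3 : 2 * L / e * d = 2 * L * C.
    by rewrite /e; field; rewrite ?gt_eqF.
  by rewrite /M -natr1 mulrDl mul1r; lra.
- move=> k; apply: measurableI; first by apply: measurableI => //; exact: measurable_ball_prod.
  rewrite (_ : cell k = \bigcap_(i in [set: 'I_n]) (fun z => u z i - u z0 i + L) @^-1`
      [set` `[(k i)%:R * e, (k i).+1%:R * e[ ]).
    apply: fin_bigcap_measurable => // i _.
    rewrite -[X in measurable X]setTI.
    suff : measurable_fun setT (fun z => u z i - u z0 i + L).
      by apply => //; exact: measurable_itv.
    apply: measurable_funD => //; apply: measurable_funB => //.
    exact: measurable_twist_map.
  apply/seteqP; split=> [z kz i _|z kz i]; first by rewrite /= in_itv/=; exact: kz.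
  by have := kz i I; rewrite /= in_itv.
- move=> z [Sz zr].
  pose x i := (u z i - u z0 i + L) / e.
  have x0 i : 0 <= x i.
    by rewrite divr_ge0//; [have := uL z i zr; rewrite ler_norml => /andP[]; lra|exact: ltW].
  have xM i : (Num.truncn (x i) < M)%N.
    rewrite ltnS le_truncn// ler_wpM2r//; first by rewrite invr_ge0 ltW.
    by have := uL z i zr; rewrite ler_norml => /andP[]; lra.
  exists [ffun i => Ordinal (xM i)] => //; split => // i; rewrite ffunE /=.
  have := truncn_itv (x0 i).
  by rewrite /x ler_pdivlMr// ltr_pdivrMr.
- move=> k z z' [[Sz zr] kz] [[Sz' zr'] kz'].
  have [h1 h2] := H _ _ zr zr'.
  have ud : `|z - z'| <= d.
    apply: (le_trans (h2 (monoS Sz Sz'))).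
    rewrite -(@ler_pM2l _ C^-1) ?invr_gt0// mulrA mulVf ?gt_eqF// mul1r.
    apply: ler_row_norm; first by rewrite mulr_ge0 ?invr_ge0 ?ltW.
    move=> i; rewrite mx_subE -/(u z i) -/(u z' i) mulrC -/e.
    move: (kz i) (kz' i); rewrite -natr1 => /andP[a1 a2] /andP[b1 b2].
    by rewrite ler_norml; apply/andP; split; lra.
  split => //; apply: (le_trans h1).
  apply: (@le_trans _ _ (C * d ^+ 2)).
    by rewrite ler_wpM2l ?(ltW C0)// lerXn2r ?nnegrE// ltW.
  by rewrite ler_wpM2r ?sqr_ge0//; lra.
Qed.

End covering.

(** * The cost on the product of the supports *)

Section msupport.
Context (R : realType) (n : nat).
Local Notation V := 'rV[R]_n.
Local Notation Z := (V * V)%type.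

Lemma closed_msupport (mu : {measure set V -> \bar R}) : closed (msupport mu).
Proof.
suff oC : open (~` msupport mu) by rewrite -openC.
have -> : ~` msupport mu = \bigcup_(U in [set U : set V | open U /\ ~ (0 < mu U)%E]) U.
  apply/seteqP; split=> x; last by move=> [U [oU U0] Ux] /(_ U oU Ux).
  by move=> /existsNP[U /not_implyP[oU /not_implyP[Ux U0]]]; exists U.
by apply: bigcup_open => U [].
Qed.

Lemma measurable_msupport (mu : {measure set V -> \bar R}) :
  measurable (msupport mu).
Proof.
rewrite -[msupport mu]setCK; apply: measurableC; apply: open_measurable_mx.
by rewrite openC; exact: closed_msupport.
Qed.

Variables (mu nu : probability V R) (g : probability Z R).
Hypothesis cg : coupling mu nu g.

Lemma plan_support_sub : plan_support g `<=` msupport mu `*` msupport nu.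
Proof.
move=> z Sz; split => /= U oU Uz.
- have [h _] := cg; rewrite -h; last exact: open_measurable_mx.
  apply: Sz => //; apply: open_comp => // w _; exact: cvg_fst.
- have [_ h] := cg; rewrite -h; last exact: open_measurable_mx.
  apply: Sz => //; apply: open_comp => // w _; exact: cvg_snd.
Qed.

(** The complement of the support is a countable union of null boxes. *)
Lemma plan_support_ae : {ae g, forall z, plan_support g z}.
Proof.
exists (~` plan_support g); split => //; last exact: plan_support_full.
by apply: measurableC; exact: measurable_plan_support.
Qed.

End msupport.

Section cost.
Context (R : realType) (n : nat).
Local Notation V := 'rV[R]_n.
Local Notation Z := (V * V)%type.
Variables (Omega : set V) (c : Z -> R) (mu nu : probability V R).
Hypotheses (oO : open Omega) (C2 : Ck_on 2 (Omega `*` Omega) c).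
Hypotheses (smu : compactly_supported_in Omega mu)
           (snu : compactly_supported_in Omega nu).

Definition product_support : set Z := msupport mu `*` msupport nu.

Lemma measurable_product_support : measurable product_support.
Proof. by apply: measurableX; exact: measurable_msupport. Qed.

Lemma product_support_sub : product_support `<=` Omega `*` Omega.
Proof. by move=> z [z1 z2]; split; [exact: smu.2|exact: snu.2]. Qed.

Lemma compact_product_support : compact product_support.
Proof. by apply: compact_setX; [exact: smu.1|exact: snu.1]. Qed.

Lemma coupling_product_support_ae (g : probability Z R) : coupling mu nu g ->
  {ae g, forall z, product_support z}.
Proof.
move=> cg; apply: filterS (plan_support_ae g) => z.
exact: (plan_support_sub cg).
Qed.

Lemma continuous_cost z : (Omega `*` Omega) z -> {for z, continuous c}.
Proof. by move=> Oz; apply: differentiable_continuous; exact: C2.1. Qed.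

Lemma cost_bounded : exists2 M : R, 0 <= M & forall z, product_support z -> `|c z| <= M.
Proof.
have /compact_bounded[M [_ /(_ (Num.max 0 M + 1))]] : compact (c @` product_support).
  apply: continuous_compact; last exact: compact_product_support.
  apply: continuous_in_subspaceT => z; rewrite inE => Kz.
  by apply: continuous_cost; exact: product_support_sub.
have M0 : M < Num.max 0 M + 1.
  by rewrite (@le_lt_trans _ _ (Num.max 0 M)) ?ltrDl// le_max lexx orbT.
move=> /(_ M0) H; exists (Num.max 0 M + 1).
  by rewrite addr_ge0// le_max lexx.
by move=> z Kz; apply: H; exists z.
Qed.

(** The cost is only meaningful on [Omega `*` Omega].  Cutting it off outside
    the product of the supports, which carries every coupling, and adding a constant
    makes it bounded, nonnegative and measurable everywhere. *)
Definition shifted_cost (M : R) (z : Z) : R := (c z + M) * \1_product_support z.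

Lemma measurable_shifted_cost M : measurable_fun setT (shifted_cost M).
Proof.
rewrite (_ : shifted_cost M = (fun z => c z + M) \_ product_support); last first.
  apply/funext => z; rewrite /shifted_cost patchE indicE.
  by case: ifPn => _; rewrite ?mulr1 ?mulr0.
apply/(measurable_restrictT _ measurable_product_support).
apply: (measurable_funS _ product_support_sub).
  by apply: open_measurable_prod; exact: open_setX.
apply: measurable_funD => //; apply: measurable_fun_continuous_on.
  exact: open_setX.
by move=> z; exact: continuous_cost.
Qed.

Section bounded.
Variable M : R.
Hypotheses (M0 : 0 <= M) (cM : forall z, product_support z -> `|c z| <= M).

Lemma shifted_cost_bound z : 0 <= shifted_cost M z <= 2 * M.
Proof.
rewrite /shifted_cost indicE; case: (boolP (z \in product_support)) => [/set_mem/cM|_].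
  by rewrite ler_norml mulr1 => /andP[]; lra.
by rewrite mulr0 lexx mulr_ge0.
Qed.

Lemma shifted_costE z : product_support z -> shifted_cost M z = c z + M.
Proof. by move=> Kz; rewrite /shifted_cost indicE mem_set// mulr1. Qed.

Lemma integrable_shifted_cost (g : probability Z R) :
  g.-integrable setT (EFin \o shifted_cost M).
Proof.
apply/integrableP; split; first by apply/measurable_EFinP; exact: measurable_shifted_cost.
apply: (@le_lt_trans _ _ (\int[g]_z (2 * M)%:E)%E); last first.
  by rewrite integral_probability_cst ltry.
apply: ge0_le_integral => //.
- by apply: measurableT_comp => //; apply/measurable_EFinP; exact: measurable_shifted_cost.
- move=> z _ /=; rewrite lee_fin.
  by have /andP[h1 h2] := shifted_cost_bound z; rewrite ger0_norm.
Qed.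

Lemma transport_costE (g : probability Z R) : coupling mu nu g ->
  transport_cost Omega c g = (\int[g]_z (shifted_cost M z)%:E - M%:E)%E.
Proof.
move=> cg.
have mOO : measurable (Omega `*` Omega : set Z).
  by apply: open_measurable_prod; exact: open_setX.
rewrite -[X in (_ - X)%E](integral_probability_cst g M) -integralB//; last 2 first.
- exact: integrable_shifted_cost.
- apply/integrableP; split => //=.
  by rewrite integral_probability_cst ltry.
rewrite /transport_cost [LHS]integral_mkcond; apply: ae_eq_integral => //.
- apply/(measurable_restrictT _ mOO); apply/measurable_EFinP.
  apply: measurable_fun_continuous_on; first exact: open_setX.
  by move=> z; exact: continuous_cost.
- apply/measurable_EFinP; apply: measurable_funB => //.
  exact: measurable_shifted_cost.
- apply: filterS (coupling_product_support_ae cg) => z Kz _ /=.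
  rewrite patchE mem_set; last exact: product_support_sub.
  by rewrite shifted_costE// -EFinD; congr EFin; ring.
Qed.

Lemma shifted_cost_fin (g : probability Z R) :
  (\int[g]_z (shifted_cost M z)%:E)%E \is a fin_num.
Proof. by have := integral_fune_fin_num measurableT (integrable_shifted_cost g). Qed.

End bounded.

End cost.

(** * Monotonicity of optimal plans *)

Lemma integral_indic_comb d (T : measurableType d) (R : realType)
    (P : probability T R) (A B : set T) (a b : R) :
  measurable A -> measurable B -> 0 <= a -> 0 <= b ->
  (\int[P]_x (a * \1_A x + b * \1_B x)%:E)%E =
  (a * fine (P A) + b * fine (P B))%:E.
Proof.
move=> mA mB a0 b0.
have m1 (X : set T) : measurable X -> measurable_fun setT (fun x => (\1_X x : R)%:E).
  by move=> mX; apply/measurable_EFinP.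
under eq_integral do rewrite EFinD !EFinM.
rewrite ge0_integralD//; first last.
- by apply: measurable_funeM; exact: m1.
- by move=> x _; rewrite mule_ge0 ?lee_fin.
- by apply: measurable_funeM; exact: m1.
- by move=> x _; rewrite mule_ge0 ?lee_fin.
rewrite !ge0_integralZl//; [|exact: m1|exact: m1].
rewrite !integral_indic// !setIT EFinD !EFinM !fineK//; exact: fin_num_measure.
Qed.

Section exchange.
Context d1 d2 (T1 : measurableType d1) (T2 : measurableType d2) (R : realType).
Local Notation Z := (T1 * T2)%type.
Variables (g : probability Z R) (U1 U2 : set Z) (c : Z -> R) (k : R).
Hypotheses (mU1 : measurable U1) (mU2 : measurable U2).
Hypotheses (U1_gt0 : (0 < g U1)%E) (U2_gt0 : (0 < g U2)%E).
Hypotheses (mc : measurable_fun setT c) (c0 : forall z, 0 <= c z).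
Hypotheses (k0 : 0 < k) (gain : forall z z', U1 z -> U2 z' ->
  c (z.1, z'.2) + c (z'.1, z.2) + k <= c z + c z').

(** Draw one point in [U1] and the other one in [U2], in either order: the
    factor [2^-1] keeps the exchanged mass below the mass of the plan. *)
Lemma exists_exchange : exists2 g' : probability Z R,
  (forall mu nu, coupling mu nu g -> coupling mu nu g') &
  exists2 l : R, 0 < l &
  (\int[g']_z (c z)%:E + \int[g']_z (c z)%:E + l%:E <=
   \int[g]_z (c z)%:E + \int[g]_z (c z)%:E)%E.
Proof.
have ind X : measurable X -> measurable_fun setT (\1_X : Z -> R) by [].
have prob X : measurable X -> (0 < g X)%E ->
    exists q, [/\ g X = q%:E, 0 < q & q <= 1].
  move=> mX X0; exists (fine (g X)).
  have gE : g X = (fine (g X))%:E by rewrite fineK// fin_num_measure.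
  split=> //; first by rewrite -lte_fin -gE.
  by rewrite -lee_fin -gE probability_le1.
have [q1 [q1E p1 q11]] := prob _ mU1 U1_gt0.
have [q2 [q2E p2 q21]] := prob _ mU2 U2_gt0.
have i1 X (z : Z) : 0 <= (\1_X z : R) <= 1.
  by rewrite indicE; case: (z \in X); rewrite ?ler01 ?lexx.
pose W (p : Z * Z) : R :=
  2^-1 * \1_U1 p.1 * \1_U2 p.2 + 2^-1 * \1_U2 p.1 * \1_U1 p.2.
pose D (z : Z) : R := 2^-1 * q2 * \1_U1 z + 2^-1 * q1 * \1_U2 z.
pose V (z : Z) : R := 1 - D z.
have mW : measurable_fun setT W.
  apply: measurable_funD; apply: measurable_funM.
  - by apply: measurable_funM => //; apply: (measurableT_comp (ind _ mU1)).
  - exact: (measurableT_comp (ind _ mU2)).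
  - by apply: measurable_funM => //; apply: (measurableT_comp (ind _ mU2)).
  - exact: (measurableT_comp (ind _ mU1)).
have W0 p : 0 <= W p.
  by rewrite /W addr_ge0// !mulr_ge0 ?invr_ge0//; have /andP[] := i1 U1 p.1.
have mV : measurable_fun setT V.
  apply: (measurable_funB (measurable_cst _)).
  exact: (measurable_funD (measurable_funM (measurable_cst _) (ind _ mU1))
                          (measurable_funM (measurable_cst _) (ind _ mU2))).
have D01 z : 0 <= D z <= 1.
  rewrite /D; have /andP[a0 a1] := i1 U1 z; have /andP[b0 b1] := i1 U2 z.
  have h1 : q2 * \1_U1 z <= 1 by rewrite mulr_ile1// ltW.
  have h2 : q1 * \1_U2 z <= 1 by rewrite mulr_ile1// ltW.
  have h3 : 0 <= q2 * \1_U1 z by rewrite mulr_ge0// ltW.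
  have h4 : 0 <= q1 * \1_U2 z by rewrite mulr_ge0// ltW.
  by lra.
have V0 z : 0 <= V z by rewrite subr_ge0; have /andP[] := D01 z.
have Wsym z z' : W (z, z') = W (z', z) by rewrite /W /=; ring.
have WD z : (\int[g]_z' (W (z, z'))%:E)%E = (D z)%:E.
  rewrite /W /=.
  under eq_integral do rewrite [X in X%:E](addrC).
  rewrite (integral_indic_comb g mU1 mU2); last 2 first.
  - by rewrite mulr_ge0 ?invr_ge0//; have /andP[] := i1 U2 z.
  - by rewrite mulr_ge0 ?invr_ge0//; have /andP[] := i1 U1 z.
  by congr EFin; rewrite /D q1E q2E /=; ring.
have WV1 z : (\int[g]_z' (W (z, z'))%:E + (V z)%:E)%E = 1%E.
  by rewrite WD -EFinD /V addrC subrK.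
have [g' sg'] := exists_shuffle mW W0 mV V0 WV1.
exists g'; first by move=> mu nu; exact: (shuffle_coupling mW W0 mV V0 Wsym WV1 sg').
have mass : (\int[g \x g]_p (W p)%:E)%E = (q1 * q2)%:E.
  have mWE : measurable_fun setT (EFin \o W) by exact/measurable_EFinP.
  have WE0 p : (0 <= (EFin \o W) p)%E by rewrite lee_fin.
  rewrite [LHS](@fubini_tonelli1 _ _ _ _ _ g g (EFin \o W) mWE WE0).
  rewrite /fubini_F /=; under eq_integral do rewrite WD.
  rewrite (integral_indic_comb g mU1 mU2); last 2 first.
  - by rewrite mulr_ge0 ?invr_ge0// ltW.
  - by rewrite mulr_ge0 ?invr_ge0// ltW.
  by congr EFin; rewrite q1E q2E /=; field.
have := shuffle_cost mW W0 mV V0 Wsym WV1 sg' mc c0 (ltW k0) (lexx 0).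
rewrite mass mul0e adde0 => H.
exists (k * (q1 * q2)); first by rewrite !mulr_gt0.
rewrite EFinM; apply: H => z z'.
have [|Wn0] := eqVneq (W (z, z')) 0; first by move=> ->; rewrite !mul0r.
rewrite ler_wpM2l// addr0.
have [[z1U z2U]|n1] := pselect (U1 z /\ U2 z'); first exact: gain.
have [[z1U z2U]|n2] := pselect (U2 z /\ U1 z').
  by have := gain z2U z1U; lra.
case/eqP: Wn0.
have ind0 (X Y : set Z) : ~ (X z /\ Y z') -> \1_X z * \1_Y z' = 0 :> R.
  move=> nXY; rewrite !indicE.
  case: (boolP (z \in X)) => [/set_mem Xz|]; last by rewrite mul0r.
  case: (boolP (z' \in Y)) => [/set_mem Yz|]; last by rewrite mulr0.
  by case: nXY.
by rewrite /W /= -!mulrA !ind0// !mulr0 addr0.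
Qed.

End exchange.

Section optimal_monotone.
Context (R : realType) (n : nat).
Local Notation V := 'rV[R]_n.
Local Notation Z := (V * V)%type.
Variables (Omega : set V) (c : Z -> R) (mu nu : probability V R).
Hypotheses (oO : open Omega) (C2 : Ck_on 2 (Omega `*` Omega) c).
Hypotheses (smu : compactly_supported_in Omega mu)
           (snu : compactly_supported_in Omega nu).
Variable g : probability Z R.
Hypothesis og : optimal_plan Omega c mu nu g.

Lemma mixed_difference_near (z1 z2 : Z) (k : R) :
  (Omega `*` Omega) z1 -> (Omega `*` Omega) z2 -> 0 < k ->
  exists2 e : R, 0 < e & forall z z', ball z1 e z -> ball z2 e z' ->
    mixed_difference c z z' <= mixed_difference c z1 z2 + k.
Proof.
move=> [x1O y1O] [x2O y2O] k0.
have cont w : (Omega `*` Omega) w ->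
    exists2 e : R, 0 < e & forall w', ball w e w' -> `|c w - c w'| <= k / 4.
  move=> Ow; have k4 : 0 < k / 4 by rewrite divr_gt0.
  have /cvgrPdist_le /(_ _ k4) /nbhs_ballP[e /= e0 H] := continuous_cost C2 Ow.
  by exists e => // w' /H.
have [e1 e10 h1] := cont (z1.1, z2.2) (conj x1O y2O).
have [e2 e20 h2] := cont (z2.1, z1.2) (conj x2O y1O).
have [e3 e30 h3] := cont z1 (conj x1O y1O).
have [e4 e40 h4] := cont z2 (conj x2O y2O).
exists (Num.min (Num.min e1 e2) (Num.min e3 e4)); first by rewrite !lt_min e10 e20 e30.
move=> z z'; set e := Num.min _ _.
have [l1 l2] : e <= e1 /\ e <= e2.
  by rewrite /e !ge_min !lexx /= !orbT.
have [l3 l4] : e <= e3 /\ e <= e4.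
  by rewrite /e !ge_min !lexx /= !orbT.
move=> zz zz'.
have a1 := h3 _ (le_ball l3 zz); have a2 := h4 _ (le_ball l4 zz').
have a3 : `|c (z1.1, z2.2) - c (z.1, z'.2)| <= k / 4.
  by apply: h1; split => /=; apply: (le_ball l1); [exact: zz.1|exact: zz'.2].
have a4 : `|c (z2.1, z1.2) - c (z'.1, z.2)| <= k / 4.
  by apply: h2; split => /=; apply: (le_ball l2); [exact: zz'.1|exact: zz.2].
move: a1 a2 a3 a4; rewrite /mixed_difference !ler_norml.
move=> /andP[? ?] /andP[? ?] /andP[? ?] /andP[? ?]; lra.
Qed.

(** If the mixed difference were negative at two points of the support, it
    would stay so, by continuity, for points in small balls around them; these balls
    have positive mass and [exists_exchange] would improve the plan. *)
Lemma optimal_monotone (z1 z2 : Z) : plan_support g z1 -> plan_support g z2 ->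
  0 <= mixed_difference c z1 z2.
Proof.
move=> S1 S2; rewrite leNgt; apply/negP => md0.
have [cg gmin] := og.
have K1 := plan_support_sub cg S1; have K2 := plan_support_sub cg S2.
have O1 := product_support_sub smu snu K1; have O2 := product_support_sub smu snu K2.
pose k : R := - mixed_difference c z1 z2 / 2.
have k0 : 0 < k by rewrite divr_gt0// oppr_gt0.
have [e e0 He] := mixed_difference_near O1 O2 k0.
have [M M0 cM] := cost_bounded C2 smu snu.
pose U1 := ball z1 e `&` product_support mu nu; pose U2 := ball z2 e `&` product_support mu nu.
have mK := measurable_product_support mu nu.
have mU1 : measurable U1 by apply: measurableI => //; exact: measurable_ball_prod.
have mU2 : measurable U2 by apply: measurableI => //; exact: measurable_ball_prod.
have pos (z : Z) : plan_support g z -> (0 < g (ball z e `&` product_support mu nu))%E.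
  move=> Sz; have := Sz _ (ball_open z e) (ballxx z e0).
  rewrite (measureDI _ (measurable_ball_prod z e0) mK).
  rewrite [X in (_ < X + _)%E](_ : _ = 0%E) ?add0e//.
  apply: measure_negligible; first by apply: measurableD => //; exact: measurable_ball_prod.
  by apply: negligibleS (coupling_product_support_ae cg) => w [_].
have mc := measurable_shifted_cost oO C2 smu snu M.
have c0 z : 0 <= shifted_cost c mu nu M z.
  by have /andP[] := shifted_cost_bound M0 cM z.
have [|g' /(_ _ _ cg) cg' [l l0]] :=
    exists_exchange mU1 mU2 (pos _ S1) (pos _ S2) mc c0 k0.
  move=> z z' [zz Kz] [zz' Kz'].
  rewrite !shifted_costE//; last 2 first.
  - by split; [exact: Kz'.1|exact: Kz.2].
  - by split; [exact: Kz.1|exact: Kz'.2].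
  have := He _ _ zz zz'; rewrite /k /mixed_difference; lra.
have tr h (ch : coupling mu nu h) := transport_costE oO C2 smu snu M0 cM ch.
have := gmin _ cg'; rewrite !tr//.
have fin h := shifted_cost_fin oO C2 smu snu M0 cM h.
rewrite -(fineK (fin g)) -(fineK (fin g')) -!EFinB -!EFinD !lee_fin; lra.
Qed.

End optimal_monotone.

(** * Gibbs' inequality and Gaussian densities *)

Section law.
Local Open Scope ereal_scope.
Context d d' (T : measurableType d) (T' : measurableType d') (R : realType).
Variables (P : probability T' R) (X : T' -> T) (mu : probability T R).
Hypothesis mX : measurable_fun setT X.
Hypothesis XE : forall B, measurable B -> P (X @^-1` B) = mu B.

Lemma ge0_integral_law (phi : T -> \bar R) : measurable_fun setT phi ->
  (forall x, 0 <= phi x) -> \int[mu]_x phi x = \int[P]_w phi (X w).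
Proof.
move=> mphi phi0.
have [N [NE NI]] := exists_pushforward P mX.
rewrite -(NI _ mphi phi0); apply: eq_measure_integral => A mA _.
exact: etrans (esym (XE mA)) (esym (NE A)).
Qed.

Lemma integral_law (phi : T -> \bar R) : measurable_fun setT phi ->
  \int[mu]_x phi x = \int[P]_w phi (X w).
Proof.
move=> mphi; rewrite integralE [RHS]integralE.
rewrite (ge0_integral_law (measurable_funepos mphi))//.
rewrite (ge0_integral_law (measurable_funeneg mphi))//.
by congr (_ - _); apply: eq_integral => w _; rewrite ?funeposE ?funenegE.
Qed.

Lemma law_ae (A : set T) : {ae mu, forall x, A x} -> {ae P, forall w, A (X w)}.
Proof.
move=> [N [mN N0 NA]]; exists (X @^-1` N); split.
- by rewrite -[X in measurable X]setTI; exact: mX.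
- exact: etrans (XE mN) N0.
- by move=> w /= Aw; apply: NA.
Qed.

(** Gibbs' inequality [H(mu) >= \int ln q dmu] for a subprobability density
    [q], from [ln f >= ln q + 1 - q / f].  The lower bound on [ln q] is given as
    [A - L] on a space that carries a coupling, where [L] will be the squared
    distance to a second variable. *)
Lemma gibbs (m : {sigma_finite_measure set T -> \bar R}) (f q : T -> R)
    (L : T' -> R) (A l : R) :
  is_density m mu f -> measurable_fun setT q -> (forall x, 0 < q x)%R ->
  \int[m]_x (q x)%:E <= 1 ->
  measurable_fun setT L -> (forall w, 0 <= L w)%R -> \int[P]_w (L w)%:E <= l%:E ->
  {ae P, forall w, (A - L w <= ln (q (X w)))%R} ->
  (A - l)%:E <= \int[mu]_x (ln (f x))%:E.
Proof.
move=> fd mq q0 q1 mL L0 Ll H; have [mf f0 fE] := fd.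
have mlnf : measurable_fun setT (fun x => (ln (f x))%:E).
  by apply/measurable_EFinP; apply: measurableT_comp.
(* This is [q / f] where [f] is positive, and stays measurable elsewhere. *)
pose r x := expR (ln (q x) - ln (f x)).
have mr : measurable_fun setT r.
  apply: measurableT_comp => //; apply: measurable_funB; exact: measurableT_comp.
have r1 : \int[P]_w (r (X w))%:E <= 1.
  rewrite -(@ge0_integral_law (EFin \o r)); last 2 first.
  - exact/measurable_EFinP.
  - by move=> x; rewrite lee_fin expR_ge0.
  rewrite (ge0_integral_density mf f0 fE); last 2 first.
  - exact/measurable_EFinP.
  - by move=> x; rewrite lee_fin expR_ge0.
  apply: le_trans q1; apply: ge0_le_integral => //.
  - by move=> x _; rewrite lee_fin mulr_ge0// expR_ge0.
  - by apply/measurable_EFinP; exact: measurable_funM.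
  - exact/measurable_EFinP.
  - move=> x _; rewrite lee_fin /r.
    have := f0 x; rewrite le_eqVlt => /predU1P[<-|fx]; first by rewrite mulr0 ltW.
    by rewrite expRB !lnK ?posrE// divfK// gt_eqF.
have iL : P.-integrable setT (EFin \o L).
  apply/integrableP; split; first exact/measurable_EFinP.
  under eq_integral do rewrite /= ger0_norm//.
  exact: le_lt_trans Ll (ltry _).
have ir : P.-integrable setT (fun w => (r (X w))%:E).
  apply/integrableP; split; first by apply/measurable_EFinP; exact: measurableT_comp.
  under eq_integral do rewrite /= ger0_norm ?expR_ge0//.
  exact: le_lt_trans r1 (ltry _).
have icst : P.-integrable setT (cst (A + 1)%:E).
  by apply/integrableP; split => //=; rewrite integral_probability_cst ltry.
have e1 : \int[P]_w ((A + 1)%:E - (L w)%:E - (r (X w))%:E) =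
    (A + 1)%:E - \int[P]_w (L w)%:E - \int[P]_w (r (X w))%:E.
  rewrite integralB//; last exact: integrableB.
  by rewrite integralB// integral_probability_cst.
rewrite (integral_law mlnf).
apply: (@le_trans _ _ (\int[P]_w ((A + 1)%:E - (L w)%:E - (r (X w))%:E))); last first.
  apply: le_ae_integral.
  - apply: emeasurable_funB; last exact: measurable_int ir.
    by apply: emeasurable_funB => //; exact/measurable_EFinP.
  - exact: (measurableT_comp mlnf mX).
  - apply: filterS H => w Hw; rewrite -!EFinB lee_fin.
    have := expR_ge1Dx (ln (q (X w)) - ln (f (X w))); rewrite -/(r _) => h.
    by lra.
rewrite e1.
have [Lf rf] : \int[P]_w (L w)%:E \is a fin_num /\ \int[P]_w (r (X w))%:E \is a fin_num.
  by split; [exact: (integral_fune_fin_num measurableT iL)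
            |exact: (integral_fune_fin_num measurableT ir)].
move: Ll r1; rewrite -(fineK Lf) -(fineK rf) -!EFinB !lee_fin; lra.
Qed.

End law.

Section gaussian.
Context (R : realType).

Lemma integral_lebesgue_rVS n (f : 'rV[R]_n.+1 -> \bar R) :
  measurable_fun setT f -> (forall v, (0 <= f v)%E) ->
  (\int[lebesgue_rV R n.+1]_v f v =
   \int[lebesgue_measure \x lebesgue_rV R n]_p f (rV_cons p))%E.
Proof.
move=> mf f0.
pose m : {measure set (measurableTypeR R * 'rV[R]_n)%type -> \bar R} :=
  (product_measure1 (@lebesgue_measure R) (lebesgue_rV R n) :
    set (measurableTypeR R * 'rV[R]_n)%type -> \bar R).
have f0' : {in [set: 'rV[R]_n.+1], forall v, (0 <= f v)%E} by move=> v _; exact: f0.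
have E := @ge0_integral_pushforward _ _ (measurableTypeR R * 'rV[R]_n)%type _ R
  (@rV_cons R n) (@measurable_rV_cons R n) m setT f measurableT mf f0'.
rewrite preimage_setT in E.
transitivity (\int[m]_p f (rV_cons p))%E; last by [].
rewrite -[RHS]E.
by apply: eq_measure_integral => [|A mA _]; first exact: measurable_rV_cons.
Qed.

(** Tonelli's theorem, one coordinate at a time. *)
Lemma integral_rV_prod n (h : 'I_n -> R -> R) :
  (forall i, measurable_fun setT (h i)) -> (forall i x, 0 <= h i x) ->
  (forall i, (\int[lebesgue_measure]_x (h i x)%:E = 1)%E) ->
  (\int[lebesgue_rV R n]_v (\prod_i h i (v 0 i))%:E = 1)%E.
Proof.
elim: n h => [|n IH] h mh h0 h1.
  under eq_integral do rewrite big_ord0.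
  rewrite integral_cst//= mul1e.
  by rewrite diracT.
have mp (k : nat) (g : 'I_k -> R -> R) : (forall i, measurable_fun setT (g i)) ->
    measurable_fun setT (fun v : 'rV[R]_k => (\prod_i g i (v 0 i))%:E).
  move=> mg; apply/measurable_EFinP; apply: measurable_prod => i _.
  exact: (measurableT_comp (mg i) (measurable_fun_coord _ _)).
rewrite integral_lebesgue_rVS; last 2 first.
- exact: mp.
- by move=> v; rewrite lee_fin; apply: prodr_ge0.
have E p : (\prod_(i < n.+1) h i (rV_cons p 0 i))%:E =
    ((h ord0 p.1)%:E * (\prod_(i < n) h (lift ord0 i) (p.2 0 i))%:E)%E.
  rewrite big_ord_recl rV_cons0 EFinM; congr (_ * _%:E)%E.
  by apply: eq_bigr => i _; rewrite rV_cons_lift.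
under eq_integral do rewrite E.
rewrite fubini_tonelli1; last 2 first.
- apply: emeasurable_funM.
    by apply/measurable_EFinP; exact: (measurableT_comp (mh _) measurable_fst).
  by apply: (measurableT_comp (mp n (fun i => h (lift ord0 i)) _) measurable_snd).
- by move=> p; rewrite mule_ge0// lee_fin// prodr_ge0.
rewrite -[RHS](h1 ord0); apply: eq_integral => x _; rewrite /fubini_F /=.
rewrite ge0_integralZl ?lee_fin//; last 2 first.
- exact: (mp n (fun i => h (lift ord0 i))).
- by move=> v _; rewrite lee_fin prodr_ge0.
by rewrite (IH (fun i => h (lift ord0 i)))// mule1.
Qed.

Definition gauss (n : nat) (a : 'rV[R]_n) (s : R) (v : 'rV[R]_n) : R :=
  \prod_i normal_pdf (a 0 i) s (v 0 i).

Lemma measurable_gauss n a s : measurable_fun setT (@gauss n a s).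
Proof.
apply: measurable_prod => i _.
exact: (measurableT_comp (measurable_normal_pdf _ _) (measurable_fun_coord _ _)).
Qed.

Lemma gauss_ge0 n a s v : 0 <= @gauss n a s v.
Proof. by apply: prodr_ge0 => i _; exact: normal_pdf_ge0. Qed.

Lemma integral_gauss n a s :
  (\int[lebesgue_rV R n]_v (gauss a s v)%:E = 1)%E.
Proof.
apply: (integral_rV_prod (h := fun i => normal_pdf (a 0 i) s)) => i.
- exact: measurable_normal_pdf.
- by move=> x; exact: normal_pdf_ge0.
- exact: integral_normal_pdf.
Qed.

Definition gauss2 (n : nat) (a : 'rV[R]_n * 'rV[R]_n) (s : R)
  (z : 'rV[R]_n * 'rV[R]_n) : R := gauss a.1 s z.1 * gauss a.2 s z.2.

Lemma measurable_gauss2 n a s : measurable_fun setT (@gauss2 n a s).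
Proof.
apply: measurable_funM.
- exact: (measurableT_comp (measurable_gauss _ _) measurable_fst).
- exact: (measurableT_comp (measurable_gauss _ _) measurable_snd).
Qed.

Lemma gauss2_ge0 n a s z : 0 <= @gauss2 n a s z.
Proof. by rewrite mulr_ge0// gauss_ge0. Qed.

Lemma integral_gauss2 n a s :
  (\int[lebesgue_rV R n \x lebesgue_rV R n]_z (@gauss2 n a s z)%:E = 1)%E.
Proof.
have m2 : measurable_fun setT (EFin \o @gauss2 n a s).
  by apply/measurable_EFinP; exact: measurable_gauss2.
have g2 z : (0 <= (EFin \o @gauss2 n a s) z)%E by rewrite lee_fin gauss2_ge0.
rewrite [LHS](@fubini_tonelli1 _ _ _ _ _ (lebesgue_rV R n) (lebesgue_rV R n) _ m2 g2).
rewrite -[RHS](integral_gauss a.1 s); apply: eq_integral => x _.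
rewrite /fubini_F /gauss2 /=; under eq_integral do rewrite EFinM.
rewrite ge0_integralZl ?lee_fin ?gauss_ge0//; last 2 first.
- by apply/measurable_EFinP; exact: measurable_gauss.
- by move=> v _; rewrite lee_fin gauss_ge0.
by rewrite integral_gauss mule1.
Qed.

(** [ln (2 pi) / 2], the logarithm of the normalizing factor of a standard
    Gaussian. *)
Definition gauss_const : R := ln (Num.sqrt (pi *+ 2)).

Lemma ln_gauss n (a v : 'rV[R]_n) s : 0 < s -> 0 < gauss a s v /\
  ln (gauss a s v) = - n%:R * (ln s + gauss_const)
                     - (\sum_i (v 0 i - a 0 i) ^+ 2) / (s ^+ 2 *+ 2).
Proof.
move=> s0.
have p2 : 0 < Num.sqrt (pi *+ 2) :> R by rewrite sqrtr_gt0 mulrn_wgt0// pi_gt0.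
have pk : gauss a s v = expR (- n%:R * (ln s + gauss_const)
    - (\sum_i (v 0 i - a 0 i) ^+ 2) / (s ^+ 2 *+ 2)); last first.
  by rewrite pk expR_gt0 expRK.
have nE i : normal_pdf (a 0 i) s (v 0 i) =
    expR (- (ln s + gauss_const) - (v 0 i - a 0 i) ^+ 2 / (s ^+ 2 *+ 2)).
  rewrite normal_pdfE ?gt_eqF// /normal_fun expRD; congr (_ * _); last first.
    by rewrite mulNr.
  rewrite expRN expRD /gauss_const !lnK ?posrE// /normal_peak -mulrnAr.
  by rewrite sqrtrM ?sqr_ge0// sqrtr_sqr gtr0_norm.
rewrite /gauss; under eq_bigr do rewrite nE.
rewrite -expR_sum; congr expR.
rewrite big_split /= sumr_const card_ord sumrN -mulr_suml; congr (_ - _).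
by rewrite -[LHS]mulr_natl; ring.
Qed.

End gaussian.

(** * Lower bound on the entropy near a d-dimensional plan *)

(** Sigma-finiteness of the product is needed to use densities with respect
    to it. *)
Lemma exists_sigma_finite_product d1 d2 (T1 : measurableType d1)
    (T2 : measurableType d2) (R : realType)
    (m1 : {sigma_finite_measure set T1 -> \bar R})
    (m2 : {sigma_finite_measure set T2 -> \bar R}) :
  exists m : {sigma_finite_measure set (T1 * T2)%type -> \bar R},
    m = (m1 \x m2)%E :> (set (T1 * T2) -> \bar R).
Proof.
pose m : {measure set (T1 * T2)%type -> \bar R} :=
  (product_measure1 m1 m2 : set (T1 * T2)%type -> \bar R).
have sf : sigma_finite setT m.
  have /sigma_finiteP[F [FT ndF Foo]] := sigma_finiteT m1.
  have /sigma_finiteP[G [GT ndG Goo]] := sigma_finiteT m2.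
  exists (fun k => F k `*` G k) => [|k].
    apply/seteqP; split=> // -[x v] _.
    have [i _ Fx] : (\bigcup_i F i) x by rewrite -FT.
    have [j _ Gv] : (\bigcup_i G i) v by rewrite -GT.
    exists (maxn i j) => //; split.
      by move: (x) Fx; exact/subsetPset/ndF/leq_maxl.
    by move: (v) Gv; exact/subsetPset/ndG/leq_maxr.
  have [mF Fk] := Foo k; have [mG Gk] := Goo k.
  split; first exact: measurableX.
  rewrite (_ : m _ = (m1 (F k) * m2 (G k))%E).
    by rewrite lte_mul_pinfty// ge0_fin_numE.
  exact: product_measure1E.
pose f (A : set (T1 * T2)) := m A.
pose mix1 := isMeasure.Build _ _ R f (measure0 m) (measure_ge0 m)
  (@measure_semi_sigma_additive _ _ _ m).
pose M : {measure set (T1 * T2)%type -> \bar R} := HB.pack f mix1.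
pose mix2 := Measure_isSigmaFinite.Build _ _ R M sf.
pose N : {sigma_finite_measure set (T1 * T2)%type -> \bar R} := HB.pack f mix1 mix2.
by exists N.
Qed.

Lemma ae_nonempty d (T : measurableType d) (R : realType) (P : probability T R)
    (A : set T) : {ae P, forall x, A x} -> exists x, A x.
Proof.
move=> [N [mN N0 NA]]; apply: contrapT => nA.
have NT : N = setT.
  by apply/seteqP; split => // x _; apply: NA => /= Ax; apply: nA; exists x.
have P1 : P setT = 1%E := probability_setT P.
rewrite NT in N0; move: (etrans (esym N0) P1) => /eqP.
by rewrite eqe eq_sym oner_eq0.
Qed.

Section entropy_lower.
Context (R : realType) (n : nat).
Local Notation V := 'rV[R]_n.
Local Notation Z := (V * V)%type.
Local Notation leb2 := (lebesgue_rV R n \x lebesgue_rV R n)%E.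
Variables (c : Z -> R) (C s : R) (S : set Z) (I : finType) (F : I -> set Z).
Hypotheses (s0 : 0 < s) (cov : fine_covering c C s S F).

(** A uniform mixture of Gaussians of width [s], one per piece, centred at an
    arbitrary point of the piece. *)
Definition mixture (z : Z) : R :=
  #|I|%:R^-1 * \sum_i gauss2 (xget (0, 0) (F i)) s z.

Lemma measurable_mixture : measurable_fun setT mixture.
Proof.
apply: measurable_funM => //; apply: measurable_sum => i.
exact: measurable_gauss2.
Qed.

Hypothesis I_gt0 : 0 < #|I|%:R :> R.

Lemma integral_mixture : (\int[leb2]_z (mixture z)%:E <= 1)%E.
Proof.
rewrite /mixture; under eq_integral do rewrite EFinM -sumEFin.
have mg i : measurable_fun setT (fun z : Z => (gauss2 (xget (0, 0) (F i)) s z)%:E).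
  by apply/measurable_EFinP; exact: measurable_gauss2.
rewrite ge0_integralZl ?lee_fin ?invr_ge0//; last 2 first.
- exact: emeasurable_sum.
- by move=> z _; apply: sume_ge0 => i _; rewrite lee_fin gauss2_ge0.
rewrite ge0_integral_sum//; last by move=> i z _; rewrite lee_fin gauss2_ge0.
under eq_bigr do rewrite integral_gauss2.
by rewrite sumEFin sumr_const -EFinM mulVf// gt_eqF.
Qed.

(** From [(u + v)^2 <= 2 u^2 + 2 v^2], with [v] the displacement from [y] to
    the centre [a], at most [s] in each coordinate. *)
Lemma sum_sqr_shift (x y a : V) : `|y - a| <= s ->
  (\sum_i (x 0 i - a 0 i) ^+ 2) / (s ^+ 2 *+ 2) <=
  (\sum_i (x 0 i - y 0 i) ^+ 2) / s ^+ 2 + n%:R.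
Proof.
move=> ya; have s20 : 0 < s ^+ 2 by rewrite exprn_gt0.
have : \sum_i (x 0 i - a 0 i) ^+ 2 <=
    2 * \sum_i (x 0 i - y 0 i) ^+ 2 + 2 * s ^+ 2 * n%:R.
  have -> : 2 * s ^+ 2 * n%:R = \sum_(i < n) (2 * s ^+ 2).
    by rewrite sumr_const card_ord mulr_natr.
  rewrite mulr_sumr -big_split; apply: ler_sum => i _ /=.
  have h : (y 0 i - a 0 i) ^+ 2 <= s ^+ 2.
    rewrite -mx_subE -(real_normK (num_real _)) lerXn2r ?nnegrE ?(ltW s0)//.
    exact: le_trans (ler_coord_norm _ _) ya.
  have := sqr_ge0 (x 0 i - y 0 i - (y 0 i - a 0 i)); nra.
rewrite ler_pdivrMr ?pmulrn_lgt0// => /le_trans; apply.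
rewrite le_eqVlt; apply/orP; left; apply/eqP; field.
by rewrite gt_eqF.
Qed.

(** The squared Euclidean distance in units of [s], as a sum over coordinates
    so that measurability is plain. *)
Definition dist_ratio (w : Z * Z) : R :=
  (\sum_i (w.1.1 0 i - w.2.1 0 i) ^+ 2) / s ^+ 2 +
  (\sum_i (w.1.2 0 i - w.2.2 0 i) ^+ 2) / s ^+ 2.

Lemma dist_ratioE w : dist_ratio w = eucl_dist w.1 w.2 ^+ 2 / s ^+ 2.
Proof.
rewrite /dist_ratio /eucl_dist sqr_sqrtr ?mulrDl//.
by apply: addr_ge0; apply: sumr_ge0 => i _; exact: sqr_ge0.
Qed.

Lemma measurable_dist_ratio : measurable_fun setT dist_ratio.
Proof.
have mX d (T : measurableType d) (X Y : T -> V) : measurable_fun setT X ->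
    measurable_fun setT Y ->
    measurable_fun setT (fun w => (\sum_i (X w 0 i - Y w 0 i) ^+ 2) / s ^+ 2).
  move=> mX mY; apply: measurable_funM => //; apply: measurable_sum => i.
  apply: measurable_funX; apply: measurable_funB.
  - exact: (measurableT_comp (measurable_fun_coord _ _) mX).
  - exact: (measurableT_comp (measurable_fun_coord _ _) mY).
apply: measurable_funD.
- apply: (mX _ _ (fun w : Z * Z => w.1.1) (fun w => w.2.1));
  by apply: measurableT_comp => //; exact: measurableT_comp.
- apply: (mX _ _ (fun w : Z * Z => w.1.2) (fun w => w.2.2));
  by apply: measurableT_comp => //; exact: measurableT_comp.
Qed.

Definition mixture_bound : R :=
  - ln #|I|%:R - 2 * n%:R * (ln s + gauss_const R) - 2 * n%:R.

(** If [w.2] is in the piece number [i], then [w.1] is at distance of order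
    [s + |w.1 - w.2|] from the centre of the [i]-th Gaussian, which alone is a
    fraction [1 / #|I|] of the mixture. *)
Lemma mixture_ge (w : Z * Z) : S w.2 ->
  mixture_bound - dist_ratio w <= ln (mixture w.1).
Proof.
have [_ _ SF H] := cov.
move=> /SF [i _ Fi].
have Fa : F i (xget (0, 0) (F i)) by apply: (xgetPex (0, 0)); exists w.2.
have [wa _] := H i _ _ Fi Fa.
move: wa; set a := xget _ _ => wa.
have [g1 l1] := ln_gauss a.1 w.1.1 s0; have [g2 l2] := ln_gauss a.2 w.1.2 s0.
have gg : 0 < gauss2 a s w.1 by rewrite mulr_gt0.
have le : #|I|%:R^-1 * gauss2 a s w.1 <= mixture w.1.
  rewrite /mixture ler_wpM2l ?invr_ge0 ?(ltW I_gt0)// (bigD1 i)//= -/a lerDl.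
  by apply: sumr_ge0 => j _; exact: gauss2_ge0.
have lt0 : 0 < #|I|%:R^-1 * gauss2 a s w.1 by rewrite mulr_gt0 ?invr_gt0.
apply: (@le_trans _ _ (ln (#|I|%:R^-1 * gauss2 a s w.1))); last first.
  by rewrite ler_ln ?posrE//; exact: lt_le_trans le.
rewrite lnM ?posrE ?invr_gt0// lnV ?posrE// /gauss2 lnM ?posrE// l1 l2.
have wa1 : `|w.2.1 - a.1| <= s.
  by apply: le_trans wa; rewrite [leRHS]prod_normE le_max lexx.
have wa2 : `|w.2.2 - a.2| <= s.
  by apply: le_trans wa; rewrite [leRHS]prod_normE le_max lexx orbT.
have h1 := sum_sqr_shift w.1.1 wa1; have h2 := sum_sqr_shift w.1.2 wa2.
by rewrite /mixture_bound /dist_ratio; move: h1 h2; lra.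
Qed.

End entropy_lower.

(** A plan close to the set [S] cannot have a low entropy: the mixture puts
    density of order [1 / (#|I| s^(2n))] near [S], with [#|I|] of order [s^-n]. *)
Lemma entropy_lower_bound (R : realType) (n : nat)
    (c : 'rV[R]_n * 'rV[R]_n -> R) (C s : R) (S : set ('rV[R]_n * 'rV[R]_n))
    (I : finType) (F : I -> set ('rV[R]_n * 'rV[R]_n))
    (g g0 : probability ('rV[R]_n * 'rV[R]_n)%type R) f p :
  0 < s -> fine_covering c C s S F -> {ae g0, forall z, S z} ->
  is_density (lebesgue_rV R n \x lebesgue_rV R n)%E g f -> coupling g g0 p ->
  (\int[p]_w (eucl_dist w.1 w.2 ^+ 2)%:E <= (s ^+ 2)%:E)%E ->
  ((- n%:R * ln s - (ln C + 2 * n%:R * gauss_const R + 2 * n%:R + 1))%:E <=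
   entropy (lebesgue_rV R n \x lebesgue_rV R n)%E g)%E.
Proof.
move=> s0 cov aeS fd [cp1 cp2] dist.
have [_ [i0 _ _]] : exists z, (\bigcup_i F i) z.
  have [z Sz] := ae_nonempty aeS; exists z.
  by have [_ _ + _] := cov; exact.
have I0 : 0 < #|I|%:R :> R by rewrite ltr0n; apply/card_gt0P; exists i0.
rewrite (entropyE fd).
have msnd := @measurable_snd _ _ ('rV[R]_n * 'rV[R]_n)%type ('rV[R]_n * 'rV[R]_n)%type.
have mfst := @measurable_fst _ _ ('rV[R]_n * 'rV[R]_n)%type ('rV[R]_n * 'rV[R]_n)%type.
have q0 z : 0 < mixture s F z.
  rewrite /mixture mulr_gt0 ?invr_gt0// (bigD1 i0)//= ltr_pwDl//.
    by rewrite /gauss2 mulr_gt0//; have [] := ln_gauss (xget (0, 0) (F i0)).1 z.1 s0;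
       have [] := ln_gauss (xget (0, 0) (F i0)).2 z.2 s0.
  by apply: sumr_ge0 => j _; exact: gauss2_ge0.
have L0 (w : ('rV[R]_n * 'rV[R]_n) * ('rV[R]_n * 'rV[R]_n)) : 0 <= dist_ratio s w.
  by rewrite dist_ratioE mulr_ge0 ?invr_ge0 ?sqr_ge0.
have L1 : (\int[p]_w (dist_ratio s w)%:E <= 1%:E)%E.
  under eq_integral do rewrite dist_ratioE mulrC EFinM.
  have m2 : measurable_fun setT (fun w : ('rV[R]_n * 'rV[R]_n) * ('rV[R]_n * 'rV[R]_n) =>
      (eucl_dist w.1 w.2 ^+ 2)%:E).
    apply/measurable_EFinP.
    rewrite (_ : (fun w => _) = (fun w => dist_ratio s w * s ^+ 2)).
      by apply: measurable_funM => //; exact: measurable_dist_ratio.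
    by apply/funext => w; rewrite dist_ratioE divfK// gt_eqF// exprn_gt0.
  rewrite ge0_integralZl ?lee_fin ?invr_ge0 ?sqr_ge0//; last first.
    by move=> w _; rewrite lee_fin sqr_ge0.
  apply: le_trans (lee_wpmul2l _ dist) _; first by rewrite lee_fin invr_ge0 sqr_ge0.
  by rewrite -EFinM lee_fin mulVf// gt_eqF// exprn_gt0.
have H : {ae p, forall w, mixture_bound n s I - dist_ratio s w <= ln (mixture s F w.1)}.
  have := law_ae msnd cp2 aeS; apply: filterS => w Sw.
  exact: (mixture_ge s0 cov I0 Sw).
have [leb2 leb2E] := exists_sigma_finite_product (lebesgue_rV R n) (lebesgue_rV R n).
have leb2_int D h : (\int[leb2]_(x in D) h x =
    \int[lebesgue_rV R n \x lebesgue_rV R n]_(x in D) h x)%E.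
  by apply: eq_measure_integral => B mB _; exact: (congr1 (@^~ B) leb2E).
have fd' : is_density leb2 g f.
  by have [h1 h2 h3] := fd; split => // A mA; rewrite leb2_int; exact: h3.
have q1 : (\int[leb2]_x (mixture s F x)%:E <= 1)%E.
  by rewrite leb2_int; exact: integral_mixture I0.
have := @gibbs _ _ _ _ R p fst g mfst cp1 leb2 f _ _ _ _ fd' (measurable_mixture s F) q0 q1
  (measurable_dist_ratio s) L0 L1 H.
apply: le_trans; rewrite lee_fin /mixture_bound.
have [cardC _ _ _] := cov.
have C0 : 0 < C by apply: lt_le_trans cardC; rewrite mulr_gt0// exprn_gt0.
have : ln #|I|%:R + n%:R * ln s <= ln C.
  have -> : n%:R * ln s = ln (s ^+ n) by rewrite lnXn// mulr_natl.
  rewrite -lnM ?posrE ?exprn_gt0//.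
  by rewrite ler_ln ?posrE// mulr_gt0// exprn_gt0.
by lra.
Qed.

(** * Density of a plan shuffled in blocks *)

Section block_term.
Local Open Scope ereal_scope.
Context d1 d2 (T1 : measurableType d1) (T2 : measurableType d2) (R : realType).
Local Notation Z := (T1 * T2)%type.
Variables (g : probability Z R) (mu : probability T1 R) (nu : probability T2 R).
Variables (b : Z -> R) (k : T1 -> R) (l : T2 -> R) (a : R).
Hypotheses (mb : measurable_fun setT b) (b0 : forall z, (0 <= b z)%R).
Hypotheses (mk : measurable_fun setT k) (k0 : forall z, (0 <= k z)%R).
Hypotheses (ml : measurable_fun setT l) (l0 : forall z, (0 <= l z)%R).
Hypothesis a0 : (0 <= a)%R.
Hypothesis kE : forall phi : T1 -> \bar R, measurable_fun setT phi ->
  (forall x, 0 <= phi x) ->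
  \int[g]_z (phi z.1 * (b z)%:E) = \int[mu]_x (phi x * (k x)%:E).
Hypothesis lE : forall phi : T2 -> \bar R, measurable_fun setT phi ->
  (forall x, 0 <= phi x) ->
  \int[g]_z (phi z.2 * (b z)%:E) = \int[nu]_x (phi x * (l x)%:E).

(** Given the piece, of indicator [b], the two exchanged coordinates are
    independent; their laws have densities [k] and [l] with respect to the
    marginals of the plan. *)
Lemma block_term (phi : Z -> \bar R) : measurable_fun setT phi ->
  (forall z, 0 <= phi z) ->
  \int[g \x g]_p (phi (exchange p) * (a * b p.1 * b p.2)%:E) =
  \int[mu \x nu]_z (phi z * (a * k z.1 * l z.2)%:E).
Proof.
move=> mphi phi0.
pose F (p : Z * Z) := phi (exchange p) * (a * b p.1 * b p.2)%:E.
have mF : measurable_fun setT F.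
  apply: emeasurable_funM; first exact: (measurableT_comp mphi (@measurable_exchange _ _ _ _)).
  apply/measurable_EFinP/measurable_funM.
    apply: measurable_funM => //; exact: (measurableT_comp mb measurable_fst).
  exact: (measurableT_comp mb measurable_snd).
have F0 p : 0 <= F p by rewrite mule_ge0// lee_fin !mulr_ge0.
rewrite [LHS](@fubini_tonelli1 _ _ _ _ _ g g F mF F0).
pose G (z : Z) := phi z * (a * k z.1 * l z.2)%:E.
have mG : measurable_fun setT G.
  apply: emeasurable_funM => //; apply/measurable_EFinP/measurable_funM.
    apply: measurable_funM => //; exact: (measurableT_comp mk measurable_fst).
  exact: (measurableT_comp ml measurable_snd).
have G0 p : 0 <= G p by rewrite mule_ge0// lee_fin !mulr_ge0.
rewrite [RHS](@fubini_tonelli1 _ _ _ _ _ mu nu G mG G0) /fubini_F /F /G /=.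
pose Phi x := \int[nu]_y (phi (x, y) * (l y)%:E).
pose H (z : Z) := phi z * (l z.2)%:E.
have mH : measurable_fun setT H.
  apply: emeasurable_funM => //; apply/measurable_EFinP.
  exact: (measurableT_comp ml measurable_snd).
have H0 z : 0 <= H z by rewrite mule_ge0// lee_fin.
have mPhi : measurable_fun setT Phi.
  exact: (@measurable_fun_fubini_tonelli_F _ _ _ _ R nu H mH H0).
have Phi0 x : 0 <= Phi x by apply: integral_ge0 => y _; exact: H0.
have mphix x : measurable_fun setT (fun y => phi (x, y)).
  exact: measurableT_comp (pair1_measurable x).
transitivity (\int[g]_z ((a%:E * Phi z.1) * (b z)%:E)).
  apply: eq_integral => z _.
  rewrite /Phi -(lE (mphix z.1))// muleAC -EFinM -ge0_integralZl//; last 3 first.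
  - apply: emeasurable_funM; last exact/measurable_EFinP.
    exact: (measurableT_comp (mphix z.1) measurable_snd).
  - by move=> z' _; rewrite mule_ge0 ?lee_fin.
  - by rewrite lee_fin mulr_ge0.
  apply: eq_integral => z' _; rewrite /exchange /= [in RHS]muleCA; congr (_ * _).
rewrite (kE (phi := fun x => a%:E * Phi x)); last 2 first.
- exact: measurable_funeM.
- by move=> x; rewrite mule_ge0 ?lee_fin.
apply: eq_integral => x _.
rewrite muleAC -EFinM -ge0_integralZl//; last 3 first.
- apply: emeasurable_funM => //; exact/measurable_EFinP.
- by move=> y _; rewrite mule_ge0 ?lee_fin.
- by rewrite lee_fin mulr_ge0.
by apply: eq_integral => y _; rewrite muleCA -EFinM.
Qed.

End block_term.

Section blocks.
Local Open Scope ereal_scope.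
Context d1 d2 (T1 : measurableType d1) (T2 : measurableType d2) (R : realType).
Local Notation Z := (T1 * T2)%type.
Variables (mu : probability T1 R) (nu : probability T2 R) (g : probability Z R).
Hypothesis cg : coupling mu nu g.
Variables (I : finType) (G : I -> set Z).
Hypotheses (mG : forall i, measurable (G i)).
Hypotheses (dG : forall i j z, G i z -> G j z -> i = j).
Hypothesis fG : {ae g, forall z, (\bigcup_i G i) z}.

(** Pieces of mass zero are allowed: the convention that the inverse of zero is
    zero gives them no weight, and their mass is left in place by [block_rest]. *)
Definition mass i : R := fine (g (G i)).

Lemma mass_ge0 i : (0 <= mass i)%R.
Proof. exact: fine_ge0. Qed.

Lemma massE i : g (G i) = (mass i)%:E.
Proof. by rewrite /mass fineK// fin_num_measure. Qed.

(** Shuffling each piece: the normalization makes the new plan restricted to a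
    piece the product of the marginals of the old one. *)
Definition block_weight (p : Z * Z) : R :=
  (\sum_i (mass i)^-1 * \1_(G i) p.1 * \1_(G i) p.2)%R.

Definition block_rest (z : Z) : R :=
  (1 - \sum_i (mass i)^-1 * mass i * \1_(G i) z)%R.

Lemma measurable_piece_indic i : measurable_fun setT (\1_(G i) : Z -> R).
Proof. exact: measurable_indic. Qed.

Lemma piece_indic_ge0 i z : (0 <= (\1_(G i) z : R))%R. Proof. by []. Qed.

Lemma invmass_ge0 i : (0 <= (mass i)^-1)%R.
Proof. by rewrite invr_ge0 mass_ge0. Qed.

Lemma block_weight_ge0 p : (0 <= block_weight p)%R.
Proof. by apply: sumr_ge0 => i _; rewrite !mulr_ge0// invmass_ge0. Qed.

Lemma measurable_block_weight : measurable_fun setT block_weight.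
Proof.
apply: measurable_sum => i; apply: measurable_funM.
  apply: measurable_funM => //; exact: (measurableT_comp (measurable_piece_indic i) measurable_fst).
exact: (measurableT_comp (measurable_piece_indic i) measurable_snd).
Qed.

Lemma measurable_block_rest : measurable_fun setT block_rest.
Proof.
apply: measurable_funB => //; apply: measurable_sum => i.
by apply: measurable_funM => //; exact: measurable_piece_indic.
Qed.

Lemma sum_piece_indic (h : I -> R) i z : G i z -> (\sum_j h j * \1_(G j) z = h i)%R.
Proof.
move=> Gi; rewrite (bigD1 i)//= big1 => [|j ji].
  by rewrite addr0 indicE mem_set// mulr1.
rewrite indicE memNset ?mulr0// => Gj; move: ji.
by rewrite (dG Gj Gi) eqxx.
Qed.

Lemma sum_piece_indic_le1 (h : I -> R) z : (forall i, 0 <= h i <= 1)%R ->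
  (\sum_i h i * \1_(G i) z <= 1)%R.
Proof.
move=> h1; have [[i Gi]|nG] := pselect (exists i, G i z).
  by rewrite (sum_piece_indic _ Gi); have /andP[] := h1 i.
rewrite big1// => i _; rewrite indicE memNset ?mulr0// => Gi.
by apply: nG; exists i.
Qed.

Lemma massV_mass i : (0 <= (mass i)^-1 * mass i <= 1)%R.
Proof.
have [->|m0] := eqVneq (mass i) 0%R; first by rewrite mulr0 lexx ler01.
by rewrite mulVf// ler01 lexx.
Qed.

Lemma block_rest_ge0 z : (0 <= block_rest z)%R.
Proof. by rewrite subr_ge0; apply: sum_piece_indic_le1 => i; exact: massV_mass. Qed.

Lemma block_weight_sym z z' : block_weight (z, z') = block_weight (z', z).
Proof. by apply: eq_bigr => i _ /=; rewrite -!mulrA; congr (_ * _)%R; rewrite mulrC. Qed.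

Lemma block_weight_rest z :
  \int[g]_z' (block_weight (z, z'))%:E + (block_rest z)%:E = 1.
Proof.
rewrite /block_weight; under eq_integral do rewrite -sumEFin.
rewrite ge0_integral_sum//; last 2 first.
- move=> i /=; apply/measurable_EFinP.
  exact: (measurable_funM (measurable_cst _) (measurable_piece_indic i)).
- by move=> i z' _; rewrite lee_fin !mulr_ge0// invmass_ge0.
rewrite (eq_bigr (fun i => ((mass i)^-1 * mass i * \1_(G i) z)%:E)); last first.
  move=> i _ /=; under eq_integral do rewrite EFinM.
  have mGi : measurable_fun setT (fun z' => (\1_(G i) z')%:E : \bar R).
    by apply/measurable_EFinP; exact: measurable_piece_indic.
  have Gi0 z' : setT z' -> 0 <= (\1_(G i) z')%:E :> \bar R by rewrite lee_fin.
  have c0 : 0 <= ((mass i)^-1 * \1_(G i) z)%:E.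
    by rewrite lee_fin mulr_ge0// invmass_ge0.
  rewrite (ge0_integralZl g measurableT mGi Gi0 c0).
  rewrite integral_indic// setIT [X in _ * X](_ : _ = (mass i)%:E); last exact: massE.
  by rewrite -EFinM; congr EFin; ring.
by rewrite sumEFin -EFinD /block_rest addrC subrK.
Qed.

(** What is left in place is the mass of the null pieces. *)
Lemma block_rest_ae : {ae g, forall z, block_rest z = 0%R}.
Proof.
have null i : {ae g, forall z, mass i = 0%R -> ~ G i z}.
  have [m0|m0] := eqVneq (mass i) 0%R; last first.
    by apply: aeW => z mi; rewrite mi eqxx in m0.
  exists (G i); split => //; first by rewrite massE m0.
  by move=> z /= nGz; apply: contrapT => nG; apply: nGz => _.
have : {ae g, forall z, forall i, mass i = 0%R -> ~ G i z}.
  exact: filter_forall.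
move=> nul; apply: filterS2 fG nul => z [i _ Gi] H.
rewrite /block_rest (sum_piece_indic _ Gi) mulVf ?subrr//.
by apply/eqP => /H; apply.
Qed.

(** The density [r = \sum_i k_i l_i / p_i] with respect to
    [mu x nu], where [k_i] and [l_i] are the conditional probabilities of the piece
    [i] of mass [p_i] given either coordinate.  Since [l_i <= 1], the integral of [r]
    is at most that of [\sum_i k_i / p_i], a function of the first coordinate
    alone, whose integral counts the pieces of positive mass. *)
Lemma exists_block_density g' : is_shuffle g block_weight block_rest g' ->
  exists r : Z -> R, [/\ measurable_fun setT r, forall z, (0 <= r z)%R,
    forall phi, measurable_fun setT phi -> (forall z, 0 <= phi z) ->
      \int[g']_z phi z = \int[mu \x nu]_z (phi z * (r z)%:E) &
    \int[g']_z (r z)%:E <= (#|I|%:R)%:E].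
Proof.
move=> sh; have [cg1 cg2] := cg.
have b01 i z : (0 <= (\1_(G i) z : R) <= 1)%R.
  by rewrite indicE; case: (z \in G i); rewrite ?ler01 ?lexx.
have /choice[k kP] i :=
  exists_conditional_expectation measurable_fst cg1 (measurable_piece_indic i) (b01 i).
have /choice[l lP] i :=
  exists_conditional_expectation measurable_snd cg2 (measurable_piece_indic i) (b01 i).
have mk i : measurable_fun setT (k i) by have [] := kP i.
have ml i : measurable_fun setT (l i) by have [] := lP i.
have k0 i x : (0 <= k i x)%R by have [_ /(_ x)/andP[]] := kP i.
have l0 i x : (0 <= l i x)%R by have [_ /(_ x)/andP[]] := lP i.
have l1 i x : (l i x <= 1)%R by have [_ /(_ x)/andP[]] := lP i.
have kE i := let: And3 _ _ h := kP i in h.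
have lE i := let: And3 _ _ h := lP i in h.
pose ri i (z : Z) : R := ((mass i)^-1 * k i z.1 * l i z.2)%R.
have mri i : measurable_fun setT (ri i).
  apply: measurable_funM.
    apply: measurable_funM => //; exact: (measurableT_comp (mk i) measurable_fst).
  exact: (measurableT_comp (ml i) measurable_snd).
have ri0 i z : (0 <= ri i z)%R by rewrite /ri !mulr_ge0// invmass_ge0.
pose r z : R := (\sum_i ri i z)%R.
have mr : measurable_fun setT r by exact: measurable_sum.
have r0 z : (0 <= r z)%R by apply: sumr_ge0.
have rE phi : measurable_fun setT phi -> (forall z, 0 <= phi z) ->
    \int[g']_z phi z = \int[mu \x nu]_z (phi z * (r z)%:E).
  move=> mphi phi0; rewrite sh//.
  have -> : \int[g]_z (phi z * (block_rest z)%:E) = 0.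
    rewrite (ae_eq_integral (cst 0)) ?integral0//.
    - apply: emeasurable_funM => //; apply/measurable_EFinP.
      exact: measurable_block_rest.
    - by apply: filterS block_rest_ae => z -> _; rewrite mule0.
  rewrite adde0.
  have mphie : measurable_fun setT (fun p : Z * Z => phi (exchange p)).
    exact: (measurableT_comp mphi (@measurable_exchange _ _ _ _)).
  rewrite (eq_integral (fun p => \sum_i phi (exchange p) *
      ((mass i)^-1 * \1_(G i) p.1 * \1_(G i) p.2)%:E)); last first.
    move=> p _; rewrite /block_weight -sumEFin ge0_sume_distrr//.
    by move=> i _; rewrite lee_fin !mulr_ge0// invmass_ge0.
  rewrite ge0_integral_sum//; last 2 first.
  - move=> i; apply: emeasurable_funM => //; apply/measurable_EFinP/measurable_funM.
      apply: measurable_funM => //.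
      exact: (measurableT_comp (measurable_piece_indic i) measurable_fst).
    exact: (measurableT_comp (measurable_piece_indic i) measurable_snd).
  - by move=> i p _; rewrite mule_ge0// lee_fin !mulr_ge0// invmass_ge0.
  rewrite [RHS](eq_integral (fun z => \sum_i phi z * (ri i z)%:E)); last first.
    by move=> z _; rewrite /r -sumEFin ge0_sume_distrr// => i _; rewrite lee_fin.
  rewrite [RHS]ge0_integral_sum//; last 2 first.
  - by move=> i; apply: emeasurable_funM => //; exact/measurable_EFinP.
  - by move=> i z _; rewrite mule_ge0// lee_fin.
  apply: eq_bigr => i _; rewrite /ri.
  exact: (block_term (measurable_piece_indic i) (piece_indic_ge0 i) (mk i) (k0 i) (ml i) (l0 i)
    (invmass_ge0 i) (kE i) (lE i)).
exists r; split => //.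
have [cg1' _] := shuffle_coupling measurable_block_weight block_weight_ge0
  measurable_block_rest block_rest_ge0 block_weight_sym block_weight_rest sh cg.
pose q x : R := (\sum_i (mass i)^-1 * k i x)%R.
have mq : measurable_fun setT q.
  by apply: measurable_sum => i; exact: (measurable_funM (measurable_cst _) (mk i)).
have q0 x : (0 <= q x)%R by apply: sumr_ge0 => i _; rewrite mulr_ge0// invmass_ge0.
apply: (@le_trans _ _ (\int[g']_z (q z.1)%:E)).
  apply: ge0_le_integral => //.
  - by move=> z _; rewrite lee_fin.
  - exact/measurable_EFinP.
  - by apply/measurable_EFinP; exact: (measurableT_comp mq measurable_fst).
  - move=> z _; rewrite lee_fin; apply: ler_sum => i _.
    by rewrite /ri ler_piMr// mulr_ge0// invmass_ge0.
rewrite -(ge0_integral_law (phi := fun x => (q x)%:E) measurable_fst cg1'); last 2 first.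
- exact/measurable_EFinP.
- by move=> x; rewrite lee_fin.
have int_k i : \int[mu]_x (k i x)%:E = (mass i)%:E.
  have := kE i (cst 1) (measurable_cst _) (fun _ => lee01).
  under eq_integral do rewrite mul1e; under [RHS]eq_integral do rewrite mul1e.
  move=> <-; rewrite integral_indic// setIT; exact: massE.
rewrite /q; under eq_integral do rewrite -sumEFin.
rewrite ge0_integral_sum//; last 2 first.
- by move=> i; apply/measurable_EFinP; exact: (measurable_funM (measurable_cst _) (mk i)).
- by move=> i x _; rewrite lee_fin mulr_ge0// invmass_ge0.
rewrite (eq_bigr (fun i => ((mass i)^-1 * mass i)%:E)); last first.
  move=> i _; under eq_integral do rewrite EFinM.
  have mki : measurable_fun setT (fun x => (k i x)%:E) by exact/measurable_EFinP.
  have ki0 x : setT x -> 0 <= (k i x)%:E by rewrite lee_fin.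
  have c0 : 0 <= ((mass i)^-1)%:E by rewrite lee_fin invmass_ge0.
  by rewrite (ge0_integralZl mu measurableT mki ki0 c0) int_k.
rewrite sumEFin lee_fin; apply: (@le_trans _ _ (\sum_(i : I) 1)%R); last first.
  by rewrite sumr_const.
by apply: ler_sum => i _; have /andP[] := massV_mass i.
Qed.

End blocks.

(** * Upper bound on the entropy of a shuffled plan *)

(** A difference of extended reals is finite only if both terms are. *)
Lemma integrable_fin_num d (T : measurableType d) (R : realType)
    (mu : {measure set T -> \bar R}) (f : T -> \bar R) : measurable_fun setT f ->
  (\int[mu]_x f x)%E \is a fin_num -> mu.-integrable setT f.
Proof.
move=> mf; rewrite integralE.
have p0 : (0 <= \int[mu]_x f^\+ x)%E by apply: integral_ge0.
have n0 : (0 <= \int[mu]_x f^\- x)%E by apply: integral_ge0.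
move=> fin; apply/integrableP; split => //.
rewrite (_ : (fun x => `|f x|)%E = (fun x => f^\+ x + f^\- x)%E); last exact: fune_abse.
rewrite ge0_integralD//; [|exact: measurable_funepos|exact: measurable_funeneg].
move: fin p0 n0; case: (\int[mu]_x f^\+ x)%E => [a| |]; case: (\int[mu]_x f^\- x)%E => [b| |] //.
by rewrite -EFinD ltry.
Qed.

Section entropy_upper.
Local Open Scope ereal_scope.
Context d1 d2 (T1 : measurableType d1) (T2 : measurableType d2) (R : realType).
Local Notation Z := (T1 * T2)%type.
Variables (m1 : {sigma_finite_measure set T1 -> \bar R})
          (m2 : {sigma_finite_measure set T2 -> \bar R}).
Variables (mu : probability T1 R) (nu : probability T2 R) (g : probability Z R).
Variables (f0 : T1 -> R) (f1 : T2 -> R) (r : Z -> R).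
Hypotheses (d0 : is_density m1 mu f0) (d1' : is_density m2 nu f1).
Hypothesis cg : coupling mu nu g.
Hypotheses (mr : measurable_fun setT r) (r0 : forall z, (0 <= r z)%R).
Hypothesis rE : forall phi : Z -> \bar R, measurable_fun setT phi ->
  (forall z, 0 <= phi z) ->
  \int[g]_z phi z = \int[mu \x nu]_z (phi z * (r z)%:E).

Definition joint_density (z : Z) : R := (r z * f0 z.1 * f1 z.2)%R.

Lemma joint_densityP : is_density (m1 \x m2) g joint_density.
Proof.
have [mf0 f00 f0E] := d0; have [mf1 f10 f1E] := d1'.
have mf0' : measurable_fun setT (fun z : Z => f0 z.1).
  exact: (measurableT_comp mf0 measurable_fst).
have mf1' : measurable_fun setT (fun z : Z => f1 z.2).
  exact: (measurableT_comp mf1 measurable_snd).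
have mj : measurable_fun setT joint_density.
  by apply: measurable_funM => //; exact: measurable_funM.
have j0 z : (0 <= joint_density z)%R by rewrite /joint_density !mulr_ge0.
split => // A mA.
pose F (z : Z) : \bar R := (\1_A z * r z)%:E.
have mF : measurable_fun setT F.
  by apply/measurable_EFinP; exact: measurable_funM.
have F0 z : 0 <= F z by rewrite lee_fin mulr_ge0.
transitivity (\int[g]_z (\1_A z)%:E).
  by rewrite integral_indic// setIT.
rewrite rE; last 2 first.
- by apply/measurable_EFinP.
- by move=> z; rewrite lee_fin.
transitivity (\int[mu \x nu]_z F z); first by apply: eq_integral => z _; rewrite /F EFinM.
rewrite [LHS](@fubini_tonelli1 _ _ _ _ _ mu nu F mF F0).
pose G (z : Z) : \bar R := (\1_A z * r z * f1 z.2)%:E.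
have mG : measurable_fun setT G.
  by apply/measurable_EFinP; apply: measurable_funM => //; exact: measurable_funM.
have G0 z : 0 <= G z by rewrite lee_fin !mulr_ge0.
pose H (z : Z) : \bar R := (\1_A z * joint_density z)%:E.
have mH : measurable_fun setT H.
  by apply/measurable_EFinP; exact: measurable_funM.
have H0 z : 0 <= H z by rewrite lee_fin mulr_ge0.
transitivity (\int[m1 \x m2]_z H z); last first.
  rewrite [RHS]integral_mkcond; apply: eq_integral => z _.
  rewrite patchE /H indicE; case: (z \in A); first by rewrite mul1r.
  by rewrite mul0r.
rewrite [RHS](@fubini_tonelli1 _ _ _ _ _ m1 m2 H mH H0).
have FG x : fubini_F nu F x = fubini_F m2 G x.
  rewrite /fubini_F (ge0_integral_density mf1 f10 f1E); last 2 first.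
  - exact: (measurableT_comp mF (pair1_measurable x)).
  - by move=> y; exact: F0.
  by apply: eq_integral => y _; rewrite /F /G -EFinM.
under eq_integral do rewrite FG.
have mFG : measurable_fun setT (fubini_F m2 G).
  exact: (@measurable_fun_fubini_tonelli_F _ _ _ _ R m2 G mG G0).
rewrite (ge0_integral_density mf0 f00 f0E mFG); last first.
  by move=> x; apply: integral_ge0 => y _; exact: G0.
apply: eq_integral => x _; rewrite /fubini_F muleC.
have mGx : measurable_fun setT (fun y => G (x, y)).
  exact: (measurableT_comp mG (pair1_measurable x)).
have Gx0 y : setT y -> 0 <= G (x, y) by [].
have f0x : 0 <= (f0 x)%:E by rewrite lee_fin.
rewrite -(ge0_integralZl m2 measurableT mGx Gx0 f0x).
by apply: eq_integral => y _; rewrite /G /H /joint_density -EFinM; congr EFin; ring.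
Qed.

(** The entropy splits into those of the marginals and the integral of [ln r],
    and the concavity of the logarithm at [N] gives [ln r <= r / N - 1 + ln N]. *)
Lemma entropy_upper_bound (N h0 h1 : R) : (0 < N)%R ->
  \int[g]_z (r z)%:E <= N%:E ->
  \int[mu]_x (ln (f0 x))%:E = h0%:E -> \int[nu]_x (ln (f1 x))%:E = h1%:E ->
  entropy (m1 \x m2) g <= (h0 + h1 + ln N)%:E.
Proof.
move=> N0 rN H0 H1; rewrite (entropyE joint_densityP).
have [mf0 f00 f0E] := d0; have [mf1 f10 f1E] := d1'; have [cg1 cg2] := cg.
have mln0 : measurable_fun setT (fun x => (ln (f0 x))%:E).
  by apply/measurable_EFinP; apply: measurableT_comp.
have mln1 : measurable_fun setT (fun x => (ln (f1 x))%:E).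
  by apply/measurable_EFinP; apply: measurableT_comp.
have i0E : \int[g]_z (ln (f0 z.1))%:E = h0%:E.
  by rewrite -H0 (integral_law measurable_fst cg1 mln0).
have i1E : \int[g]_z (ln (f1 z.2))%:E = h1%:E.
  by rewrite -H1 (integral_law measurable_snd cg2 mln1).
have i0 : g.-integrable setT (fun z => (ln (f0 z.1))%:E).
  apply: integrable_fin_num; last by rewrite i0E.
  exact: (measurableT_comp mln0 measurable_fst).
have i1 : g.-integrable setT (fun z => (ln (f1 z.2))%:E).
  apply: integrable_fin_num; last by rewrite i1E.
  exact: (measurableT_comp mln1 measurable_snd).
have ir : g.-integrable setT (EFin \o r).
  apply/integrableP; split; first exact/measurable_EFinP.
  under eq_integral do rewrite /= ger0_norm//.
  exact: le_lt_trans rN (ltry _).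
have ic : g.-integrable setT (cst (ln N - 1)%:E).
  by apply/integrableP; split => //=; rewrite integral_probability_cst ltry.
have irN : g.-integrable setT (fun z => N^-1%:E * (r z)%:E).
  exact: integrableZl.
apply: (@le_trans _ _ (\int[g]_z (((ln (f0 z.1))%:E + (ln (f1 z.2))%:E) +
    (N^-1%:E * (r z)%:E + (ln N - 1)%:E)))).
  have [mj _ _] := joint_densityP.
  apply: le_ae_integral.
  - by apply/measurable_EFinP; exact: measurableT_comp.
  - apply: emeasurable_funD.
      exact: emeasurable_funD (measurable_int _ i0) (measurable_int _ i1).
    exact: emeasurable_funD (measurable_int _ irN) (measurable_int _ ic).
  - apply: filterS (density_gt0_ae joint_densityP) => z.
    rewrite /joint_density => jz.
    have p1 : (0 < f1 z.2)%R.
      rewrite lt_neqAle f10 andbT eq_sym.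
      by apply: contraTneq jz => ->; rewrite mulr0 ltxx.
    have p0 : (0 < f0 z.1)%R.
      rewrite lt_neqAle f00 andbT eq_sym.
      by apply: contraTneq jz => ->; rewrite mulr0 mul0r ltxx.
    have pr : (0 < r z)%R.
      rewrite lt_neqAle r0 andbT eq_sym.
      by apply: contraTneq jz => ->; rewrite !mul0r ltxx.
    rewrite !lnM ?posrE ?mulr_gt0// -EFinM -!EFinD lee_fin.
    have : (1 + (ln (r z) - ln N) <= r z / N)%R.
      by apply: le_trans (expR_ge1Dx _) _; rewrite expRB !lnK ?posrE.
    by rewrite [(N^-1 * _)%R]mulrC; lra.
rewrite integralD//; [|exact: integrableD|exact: integrableD].
rewrite integralD// integralD// integralZl// i0E i1E integral_probability_cst.
have rfin : \int[g]_z (r z)%:E \is a fin_num by exact: (integral_fune_fin_num measurableT ir).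
move: rN; rewrite -(fineK rfin) -EFinM -!EFinD !lee_fin => rN.
have : (N^-1 * fine (\int[g]_z (r z)%:E) <= 1)%R by rewrite mulrC ler_pdivrMr// mul1r.
by lra.
Qed.

End entropy_upper.

(** * Entropy of the minimizers *)

Lemma finite_entropy_density d (T : measurableType d) (R : realType)
    (m : {measure set T -> \bar R}) (mu : probability T R) :
  entropy m mu \is a fin_num -> exists f (h : R),
    is_density m mu f /\ (\int[mu]_x (ln (f x))%:E)%E = h%:E.
Proof.
move=> fin; have [[f fd]|nf] := pselect (exists f, is_density m mu f).
  exists f, (fine (entropy m mu)); split => //.
  by rewrite -(entropyE fd) fineK.
by move: fin; rewrite /entropy; case: pselect.
Qed.

Lemma entropy_density d (T : measurableType d) (R : realType)
    (m : {measure set T -> \bar R}) (mu : probability T R) :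
  (entropy m mu < +oo)%E -> exists f, is_density m mu f.
Proof.
have [//|nf] := pselect (exists f, is_density m mu f).
by rewrite /entropy; case: pselect.
Qed.

Lemma W2_sqr d (T : measurableType d) (R : realType) (dist : T -> T -> R)
    (mu nu : probability T R) :
  (W2 dist mu nu ^+ 2 =
   ereal_inf [set \int[g]_z (dist z.1 z.2 ^+ 2)%:E | g in coupling mu nu])%E.
Proof.
have inf0 : (0 <= ereal_inf [set \int[g]_z (dist z.1 z.2 ^+ 2)%:E | g in coupling mu nu])%E.
  apply: le_ereal_inf_tmp => _ [g _ <-]; apply: integral_ge0 => z _.
  by rewrite lee_fin sqr_ge0.
by rewrite /W2 poweR12_sqrt// sqr_sqrte.
Qed.

Lemma block_weight_neq0 d1 d2 (T1 : measurableType d1) (T2 : measurableType d2)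
    (R : realType) (g : probability (T1 * T2)%type R) (I : finType)
    (G : I -> set (T1 * T2)) z z' :
  block_weight g G (z, z') != 0 -> exists i, G i z /\ G i z'.
Proof.
move=> W0; apply: contrapT => nG; case/eqP: W0.
rewrite /block_weight big1// => i _ /=; rewrite !indicE.
case: (boolP (z \in G i)) => [/set_mem Gz|]; last by rewrite mulr0 mul0r.
case: (boolP (z' \in G i)) => [/set_mem Gz'|]; last by rewrite mulr0.
by case: nG; exists i.
Qed.

Section asymptotics.
Context (R : realType) (n : nat).
Local Notation V := 'rV[R]_n.
Local Notation Z := (V * V)%type.
Local Notation leb2 := (lebesgue_rV R n \x lebesgue_rV R n)%E.
Variables (Omega : set V) (c : Z -> R) (mu nu : probability V R).
Hypotheses (oO : open Omega) (C2 : Ck_on 2 (Omega `*` Omega) c).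
Hypothesis tw : inf_twisted Omega c.
Hypotheses (smu : compactly_supported_in Omega mu)
           (snu : compactly_supported_in Omega nu).
Variable g0 : probability Z R.
Hypothesis og : optimal_plan Omega c mu nu g0.
Let S := plan_support g0.

(** The support of an optimal plan satisfies the monotonicity that makes
    [small_dimension_local] applicable, and it is contained in a compact set. *)
Lemma plan_support_covering : exists C : R, forall s, 0 < s <= 1 ->
  exists (I : finType) (G : I -> set Z), [/\ fine_covering c C s S G,
    forall i, G i `<=` S & forall i j z, G i z -> G j z -> i = j].
Proof.
have mS : measurable S := measurable_plan_support g0.
have mono := optimal_monotone oO C2 smu snu og.
have [cg _] := og.
have SK : S `<=` product_support mu nu := plan_support_sub cg.
have [|C HC] := @small_dimension_compact R n c S _ (compact_product_support smu snu).
  move=> z /(product_support_sub smu snu) Oz.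
  exact: (small_dimension_local oO C2 tw mS mono Oz).
exists C => s /HC [I [F [h1 h2 h3 h4]]].
have cov : fine_covering c C s S (fun i => F i `&` S).
  split => //.
  - by move=> i; exact: measurableI.
  - move=> z Sz; have [i _ Fi] := h3 z (conj Sz (SK z Sz)).
    by exists i.
  - by move=> i z z' [Fz _] [Fz' _]; exact: h4 Fz Fz'.
exists I.
have [G [g1 g2 g3 g4] gd] := fine_covering_disjoint cov.
exists (fun i => G i `&` S); split => //.
- split => //.
  + by move=> i; exact: measurableI.
  + by move=> z Sz; have [i _ Gi] := g3 z Sz; exists i.
  + by move=> i z z' [Fz _] [Fz' _]; exact: g4 Fz Fz'.
- by move=> i j z [Gi _] [Gj _]; exact: gd Gi Gj.
Qed.

Variables (M : R) (f0 f1 : V -> R) (h0 h1 : R).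
Hypotheses (M0 : 0 <= M) (cM : forall z, product_support mu nu z -> `|c z| <= M).
Hypotheses (fd0 : is_density (lebesgue_rV R n) mu f0)
           (fd1 : is_density (lebesgue_rV R n) nu f1).
Hypotheses (fh0 : (\int[mu]_x (ln (f0 x))%:E)%E = h0%:E)
           (fh1 : (\int[nu]_x (ln (f1 x))%:E)%E = h1%:E).

Let plan_cost (g : probability Z R) : R := fine (\int[g]_z (shifted_cost c mu nu M z)%:E).

Lemma plan_costE (g : probability Z R) :
  (\int[g]_z (shifted_cost c mu nu M z)%:E)%E = (plan_cost g)%:E.
Proof. by rewrite /plan_cost (fineK (shifted_cost_fin oO C2 smu snu M0 cM g)). Qed.

Lemma transport_cost_shift (g : probability Z R) : coupling mu nu g ->
  transport_cost Omega c g = (plan_cost g - M)%:E.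
Proof. by move=> cg; rewrite (transport_costE oO C2 smu snu M0 cM cg) plan_costE EFinB. Qed.

(** The plan [g0] shuffled inside the pieces of size [s]. *)
Lemma block_competitor (C s : R) (I : finType) (G : I -> set Z) : 0 < s ->
  fine_covering c C s S G -> (forall i, G i `<=` S) ->
  (forall i j z, G i z -> G j z -> i = j) ->
  exists g' : probability Z R, [/\ coupling mu nu g',
    2 * plan_cost g' <= 2 * plan_cost g0 + C * s ^+ 2 &
    (entropy leb2 g' <= (h0 + h1 + ln #|I|%:R)%:E)%E].
Proof.
move=> s0 [cardC mG covG fineG] GS dG.
have [cg _] := og.
have SK : S `<=` product_support mu nu := plan_support_sub cg.
have fG : {ae g0, forall z, (\bigcup_i G i) z}.
  by apply: filterS (plan_support_ae g0) => z; exact: covG.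
have [_ [i0 _ _]] := ae_nonempty fG.
have I0 : 0 < #|I|%:R :> R by rewrite ltr0n; apply/card_gt0P; exists i0.
have C0 : 0 <= C by apply: le_trans cardC; rewrite mulr_ge0// exprn_ge0// ltW.
have mW := measurable_block_weight g0 mG.
have W0 := block_weight_ge0 g0 G.
have mV := measurable_block_rest g0 mG.
have V0 := block_rest_ge0 g0 dG.
have Wsym := block_weight_sym g0 G.
have WV := block_weight_rest g0 mG.
have [g' sg'] := exists_shuffle mW W0 mV V0 WV.
have cg' := shuffle_coupling mW W0 mV V0 Wsym WV sg' cg.
exists g'; split => //.
- have mc := measurable_shifted_cost oO C2 smu snu M.
  have c0 z : 0 <= shifted_cost c mu nu M z.
    by have /andP[] := shifted_cost_bound M0 cM z.
  have e0 : 0 <= C * s ^+ 2 by rewrite mulr_ge0// sqr_ge0.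
  have := shuffle_cost mW W0 mV V0 Wsym WV sg' mc c0 (lexx 0) e0.
  rewrite mul0e adde0 !plan_costE => H.
  have {}H :
      (((plan_cost g' + plan_cost g')%:E) <= (plan_cost g0 + plan_cost g0 + C * s ^+ 2)%:E)%E.
    rewrite EFinD; apply: le_trans (H _) _.
      move=> z z'; have [->|Wn0] := eqVneq (block_weight g0 G (z, z')) 0.
        by rewrite !mul0r.
      rewrite ler_wpM2l// addr0.
      have [i [Gz Gz']] := block_weight_neq0 Wn0.
      have [_ md] := fineG i z z' Gz Gz'.
      have Kz := SK _ (GS _ _ Gz); have Kz' := SK _ (GS _ _ Gz').
      rewrite !shifted_costE//; last 2 first.
      - by split; [exact: Kz'.1|exact: Kz.2].
      - by split; [exact: Kz.1|exact: Kz'.2].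
      by move: md; rewrite /mixed_difference; lra.
    rewrite !EFinD leeD2l// -[leRHS]mule1 lee_wpmul2l ?lee_fin//.
    exact: (shuffle_mass_le1 mW W0 mV V0 WV).
  by move: H; rewrite lee_fin; lra.
- have [r [mr r0 rE rI]] := exists_block_density cg mG dG fG sg'.
  exact: (entropy_upper_bound fd0 fd1 cg' mr r0 rE I0 rI fh0 fh1).
Qed.

(** The cost of the minimizer is at least that of [g0], which the
    competitor at scale [sqrt eps] exceeds by [O(eps)]; dividing by [eps] the
    comparison of the two entropic costs leaves a bounded term. *)
Lemma minimizer_entropy (C eps : R) (I : finType) (G : I -> set Z)
    (g : probability Z R) : 0 < eps ->
  fine_covering c C (Num.sqrt eps) S G -> (forall i, G i `<=` S) ->
  (forall i j z, G i z -> G j z -> i = j) ->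
  entropic_minimizer Omega c mu nu eps g ->
  (entropy leb2 g <= (h0 + h1 + ln #|I|%:R + C / 2)%:E)%E.
Proof.
move=> e0 cov GS dG [cg gmin].
have s0 : 0 < Num.sqrt eps by rewrite sqrtr_gt0.
have [g' [cg' Tg' Hg']] := block_competitor s0 cov GS dG.
rewrite (sqr_sqrtr (ltW e0)) in Tg'.
have [cg0 g0min] := og.
have Tg0 : plan_cost g0 <= plan_cost g.
  by have := g0min _ cg; rewrite !transport_cost_shift// lee_fin lerD2r.
have := gmin _ cg'; rewrite /entropic_cost !transport_cost_shift//.
move: Hg'; set E' := h0 + h1 + _ => Hg'.
have eE' : (eps%:E * entropy leb2 g' <= (eps * E')%:E)%E.
  by rewrite EFinM lee_wpmul2l// lee_fin ltW.
move=> H; have {H} : ((plan_cost g - M)%:E + eps%:E * entropy leb2 g <=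
    (plan_cost g' - M)%:E + (eps * E')%:E)%E.
  by apply: (le_trans H); rewrite leeD2l.
case: (entropy leb2 g) => [x| |] //.
- rewrite -EFinM -!EFinD !lee_fin => H.
  rewrite -(ler_pM2l e0); rewrite /E' in H *; move: H Tg' Tg0; lra.
- by rewrite mulry gtr0_sg// mul1e.
- by move=> _; rewrite leNye.
Qed.

End asymptotics.

(** * The lower bound on the Wasserstein distance *)

Theorem theorem4p11 (R : realType) (d : nat) (Omega : set 'rV[R]_d)
    (c : 'rV[R]_d * 'rV[R]_d -> R) (mu0 mu1 : probability 'rV[R]_d R)
    (gamma0 : probability ('rV[R]_d * 'rV[R]_d)%type R) :
  (0 < d)%N ->
  open Omega ->
  Ck_on 2 (Omega `*` Omega) c ->
  inf_twisted Omega c ->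
  compactly_supported_in Omega mu0 ->
  compactly_supported_in Omega mu1 ->
  entropy (lebesgue_rV R d) mu0 \is a fin_num ->
  entropy (lebesgue_rV R d) mu1 \is a fin_num ->
  optimal_plan Omega c mu0 mu1 gamma0 ->
  exists2 a : R, 0 < a &
    \forall eps \near 0^'+,
      forall gamma : probability ('rV[R]_d * 'rV[R]_d)%type R,
        entropic_minimizer Omega c mu0 mu1 eps gamma ->
        ((a * eps)%:E <= W2 (@eucl_dist R d) gamma gamma0 ^+ 2)%E.
Proof.
move=> d0 oO C2 tw smu snu fin0 fin1 og.
have [f0 [h0 [fd0 fh0]]] := finite_entropy_density fin0.
have [f1 [h1 [fd1 fh1]]] := finite_entropy_density fin1.
have [M M0 cM] := cost_bounded C2 smu snu.
have [C HC] := plan_support_covering oO C2 tw smu snu og.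
have dR : 0 < d%:R :> R by rewrite ltr0n.
(* The sum of the constants of the two bounds; [a] is chosen so that
   (d/2) ln (1/a) = K. *)
pose K : R := `|ln C + 2 * d%:R * gauss_const R + 2 * d%:R + 1 +
  (h0 + h1 + ln C + C / 2)| + 1.
have K0 : 0 < K by rewrite ltr_wpDl.
pose a := expR (- (2 * K / d%:R)).
exists a; first exact: expR_gt0.
have a1 : a <= 1 by rewrite -expR0 ler_expR oppr_le0 divr_ge0// mulr_ge0// ltW.
near=> eps => g gmin.
have e0 : 0 < eps by near: eps; exact: nbhs_right_gt.
have e1 : eps <= 1 by near: eps; exact: nbhs_right_le.
rewrite W2_sqr; apply: le_ereal_inf_tmp => _ [p cp <-].
rewrite leNgt; apply/negP => small.
have se0 : 0 < Num.sqrt eps by rewrite sqrtr_gt0.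
have se1 : Num.sqrt eps <= 1 by rewrite -sqrtr1 ler_wsqrtr.
have [|I [G [cov GS dG]]] := HC (Num.sqrt eps); first by rewrite se0.
(* H(gamma) <= ln #|I| + O(1), where ln #|I| <= ln C + (d/2) ln (1/eps) *)
have upper := minimizer_entropy oO C2 smu snu og M0 cM fd0 fd1 fh0 fh1
  e0 cov GS dG gmin.
have ae0 : 0 < a * eps by rewrite mulr_gt0// expR_gt0.
have s0 : 0 < Num.sqrt (a * eps) by rewrite sqrtr_gt0.
have s1 : Num.sqrt (a * eps) <= 1.
  by rewrite -sqrtr1 ler_wsqrtr// mulr_ile1// ltW// expR_gt0.
have [|I' [G' [cov' GS' dG']]] := HC (Num.sqrt (a * eps)); first by rewrite s0.
have [f fd] : exists f, is_density (lebesgue_rV R d \x lebesgue_rV R d)%E g f.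
  by apply: entropy_density; exact: le_lt_trans upper (ltry _).
have dist : (\int[p]_w (eucl_dist w.1 w.2 ^+ 2)%:E <= (Num.sqrt (a * eps) ^+ 2)%:E)%E.
  by rewrite (sqr_sqrtr (ltW ae0)) ltW.
(* H(gamma) >= d ln (1/s) - O(1) with s^2 = a eps *)
have lower := entropy_lower_bound s0 cov' (plan_support_ae gamma0) fd cp dist.
have := le_trans lower upper; rewrite lee_fin.
have lnsqrt x : 0 < x -> ln (Num.sqrt x) = ln x / 2 :> R.
  move=> x0; rewrite -[in RHS](sqr_sqrtr (ltW x0)) lnXn ?sqrtr_gt0//.
  by rewrite mulr2n; lra.
have I0 : 0 < #|I|%:R :> R.
  have [z Sz] := ae_nonempty (plan_support_ae gamma0).
  have [_ _ /(_ z Sz)[i _ _] _] := cov.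
  by rewrite ltr0n; apply/card_gt0P; exists i.
have cardC : ln #|I|%:R + d%:R * (ln eps / 2) <= ln C.
  have [cardC _ _ _] := cov.
  rewrite -lnsqrt// mulr_natl -lnXn// -lnM ?posrE ?exprn_gt0//.
  have I1 : 0 < #|I|%:R * Num.sqrt eps ^+ d by rewrite mulr_gt0// exprn_gt0.
  by rewrite ler_ln ?posrE//; exact: lt_le_trans cardC.
have lna : d%:R * (ln a / 2) = - K.
  by rewrite /a expRK; field; rewrite gt_eqF.
rewrite lnsqrt// lnM ?posrE ?expR_gt0//.
have := ler_norm (ln C + 2 * d%:R * gauss_const R + 2 * d%:R + 1 +
  (h0 + h1 + ln C + C / 2)).
move: lna cardC; rewrite /K; lra.
Unshelve. all: by end_near.
Qed.
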